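(* Let $Z=(Z_t)_{t\geq0}$ be an $n$-dimensional Lévy process starting at zero with symbol (characteristic exponent) $\psi:\mathbb{R}^n\to\mathbb{C}$. Let $\Phi:\mathbb{R}^d\to\mathbb{R}^{d\times n}$ be locally Lipschitz continuous and such that there exists $K>0$ with $|\Phi(x)|^2\leq K(1+|x|^2)$ for every $x\in\mathbb{R}^d$. Then the unique strong solution $X^x_t(\omega)$ of the stochastic differential equation $$dX_t^x=\Phi(X_{t-}^x)\,dZ_t,\qquad X_0^x=x,\quad x\in\mathbb{R}^d,$$ has the symbol $p:\mathbb{R}^d\times\mathbb{R}^d\to\mathbb{C}$ given by $$p(x,\xi)=\psi(\Phi^\top(x)\xi).$$
   Context: The symbol $\psi$ of the Lévy process $Z$ is given by $\mathbb{E}\,e^{iZ_t^\top\eta}=e^{-t\psi(\eta)}$, $\eta\in\mathbb{R}^n$. The SDE is shorthand for the system $X^{x,(j)}=x^{(j)}+\sum_{k=1}^n\int\Phi(X_-)^{jk}\,dZ^{(k)}$, $j=1,\dots,d$. Under the stated conditions it has a unique conservative strong solution. All solutions are realized on the enlarged space $\overline\Omega=\mathbb{R}^d\times\Omega$ with $\mathbb{P}^x=\varepsilon_x\times\mathbb{P}$ ($\varepsilon_x$ the Dirac measure at $x$) and filtration $\overline{\mathcal F_t}=\bigcap_{u>t}\mathcal{B}^d\otimes\mathcal{F}_u$, where $(\Omega,\mathcal F,(\mathcal F_t)_{t\ge0},\mathbb P)$ is the stochastic basis of $Z$; $\mathbb{E}^x$ is expectation under $\mathbb{P}^x$, so that under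 $\mathbb P^x$ the process $X$ is the solution started at $x$. The symbol of the process is $$p(x,\xi):=-\lim_{t\downarrow0}\mathbb{E}^x\left(\frac{e^{i(X_t^\sigma-x)^\top\xi}-1}{t}\right),$$ where $\sigma=\sigma^x_R:=\inf\{t\geq0:\|X_t^x-x\|>R\}$, $X^\sigma_t=X_{t\wedge\sigma}$, provided the limit exists for every $x,\xi\in\mathbb{R}^d$ independently of the choice of $R>0$. ''Has the symbol $p$'' means that this limit exists for all $x,\xi$, is independent of $R>0$, and equals $p(x,\xi)$. *)

(* Defs.v *)
From HB Require Import structures.
From mathcomp Require Export all_boot all_order all_algebra.
From mathcomp Require Export complex.
From mathcomp Require Export all_classical all_reals all_analysis.

Set Implicit Arguments.
Unset Strict Implicit.
Unset Printing Implicit Defensive.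

Export Order.TTheory GRing.Theory Num.Theory.
Export numFieldNormedType.Exports.

Local Open Scope classical_set_scope.
Local Open Scope ring_scope.
Local Open Scope complex_scope.

(* Processes are indexed by all of R; only their values at times t >= 0 are
   ever used.  Vectors are columns, and R^d carries its Borel sigma-algebra. *)

Section vectors.
Context {R : realType}.

(* The norm provided by the library on matrices is the maximum norm. *)
Definition frobenius m n (A : 'M[R]_(m, n)) : R :=
  Num.sqrt (\sum_i \sum_j A i j ^+ 2).

Definition dot n (u v : 'cV[R]_n) : R := (u^T *m v) ord0 ord0.

Definition locally_lipschitz d m n (f : 'cV[R]_d -> 'M[R]_(m, n)) : Prop :=
  forall x : 'cV[R]_d, exists2 U, nbhs x U & [lipschitz f y | y in U].

Definition cexp (z : R[i]) : R[i] :=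
  (expR (complex.Re z))%:C * (cos (complex.Im z) +i* sin (complex.Im z)).

Definition cexpectation dT (T : measurableType dT)
    (mu : {measure set T -> \bar R}) (f : T -> R[i]) : R[i] :=
  (\int[mu]_(w in setT) complex.Re (f w))
    +i* (\int[mu]_(w in setT) complex.Im (f w)).

End vectors.

Section processes.
Context {R : realType}.

Definition borel (E : topologicalType) : set_system E := <<s @open E >>.

Definition cadlag (T : Type) (E : ptopologicalType) (X : R -> T -> E) : Prop :=
  forall w, (forall t : R, 0 <= t -> X s w @[s --> t^'+] --> X t w) /\
            (forall t : R, 0 < t -> cvg (X s w @[s --> t^'-])).

Definition caglad (T : Type) (E : ptopologicalType) (X : R -> T -> E) : Prop :=
  forall w, (forall t : R, 0 < t -> X s w @[s --> t^'-] --> X t w) /\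
            (forall t : R, 0 <= t -> cvg (X s w @[s --> t^'+])).

(* The process X_-, with the convention X_{0-} = X_0. *)
Definition left_limit (T : Type) (E : ptopologicalType) (X : R -> T -> E) :
    R -> T -> E :=
  fun t w => if 0 < t then lim (X s w @[s --> t^'-]) else X 0 w.

(* A right-continuous, not necessarily complete, filtration. *)
Definition filtration dT (T : measurableType dT) (F : R -> set_system T) :
    Prop :=
  [/\ forall t : R, 0 <= t -> sigma_algebra setT (F t),
      forall t : R, 0 <= t -> F t `<=` measurable,
      forall s t : R, 0 <= s -> s <= t -> F s `<=` F t &
      forall t : R, 0 <= t -> \bigcap_(u in [set u | t < u]) F u `<=` F t].

Definition measurable_wrt (T : Type) (E : topologicalType) (G : set_system T)
    (f : T -> E) : Prop :=
  forall B, borel B -> G (f @^-1` B).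

Definition adapted (T : Type) (E : topologicalType) (F : R -> set_system T)
    (X : R -> T -> E) : Prop :=
  forall t : R, 0 <= t -> measurable_wrt (F t) (X t).

(* Only finite stopping times are needed. *)
Definition stopping_time (T : Type) (F : R -> set_system T) (tau : T -> R) :
    Prop :=
  (forall w, 0 <= tau w) /\
  (forall t : R, 0 <= t -> F t [set w | tau w <= t]).

Definition stopped_sigma_algebra (T : Type) (F : R -> set_system T)
    (tau : T -> R) : set_system T :=
  [set A | forall t : R, 0 <= t -> F t (A `&` [set w | tau w <= t])].

End processes.

Section stochastic_integral.
Context {R : realType}.

(* Data of the process
     H = H_* 1_{0} + \sum_(i < sp_size) H_i 1_(T_i, T_{i+1}],
   where T_i = sp_time i, H_i = sp_val i and H_* = sp_val0.  Entries of sp_time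
   and sp_val beyond sp_size are irrelevant. *)
Record simple_process (T : Type) := SimpleProcess {
  sp_size : nat;
  sp_time : nat -> T -> R;
  sp_val0 : T -> R;
  sp_val : nat -> T -> R }.

Definition simple_predictable (T : Type) (F : R -> set_system T)
    (H : simple_process T) : Prop :=
  [/\ forall w, sp_time H 0%N w = 0,
      forall i, (i < sp_size H)%N ->
        forall w, sp_time H i w <= sp_time H i.+1 w,
      forall i, (i <= sp_size H)%N -> stopping_time F (sp_time H i),
      measurable_wrt (F 0) (sp_val0 H) &
      forall i, (i < sp_size H)%N ->
        measurable_wrt (stopped_sigma_algebra F (sp_time H i)) (sp_val H i)].

Definition sp_process (T : Type) (H : simple_process T) : R -> T -> R :=
  fun t w => sp_val0 H w * (t == 0)%:R +
    \sum_(i < sp_size H)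
      sp_val H i w * (sp_time H i w < t <= sp_time H i.+1 w)%R%:R.

(* The integral over (0, t]; a jump of Z at time 0 does not contribute. *)
Definition sp_integral (T : Type) (H : simple_process T) (Z : R -> T -> R) :
    R -> T -> R :=
  fun t w => \sum_(i < sp_size H)
    sp_val H i w * (Z (Num.min t (sp_time H i.+1 w)) w -
                    Z (Num.min t (sp_time H i w)) w).

(* Uniform convergence on compacts in probability. *)
Definition cvg_ucp dT (T : measurableType dT) (mu : {measure set T -> \bar R})
    (Y : nat -> R -> T -> R) (Y0 : R -> T -> R) : Prop :=
  forall t eps : R, 0 <= t -> 0 < eps ->
    mu [set w | (eps%:E <
      ereal_sup [set `|(Y m s w - Y0 s w)%R|%:E | s in [set` `[0, t]%R]])%E]
    @[m --> \oo] --> 0%E.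

(* I is a version of \int H dZ.  As in Protter's book, the integral of an
   adapted caglad process is given by the continuous extension, for the ucp
   topologies, of the elementary integral from the simple predictable processes,
   which are ucp-dense in the adapted caglad ones; the extension exists when Z
   is a semimartingale, in particular when Z is a Levy process. *)
Definition is_stochastic_integral dT (T : measurableType dT)
    (mu : {measure set T -> \bar R}) (F : R -> set_system T)
    (H Z I : R -> T -> R) : Prop :=
  [/\ caglad H /\ adapted F H,
      cadlag I /\ adapted F I &
      forall K : nat -> simple_process T,
        (forall m, simple_predictable F (K m)) ->
        cvg_ucp mu (fun m => sp_process (K m)) H ->
        cvg_ucp mu (fun m => sp_integral (K m) Z) I].

End stochastic_integral.

Section levy_sde.
Context {R : realType} {dO : measure_display} {Omega : measurableType dO}.
Variables (P : probability Omega R) (F : R -> set_system Omega).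

(* Stochastic continuity follows from the regularity of the paths and the
   stationarity of the increments. *)
Definition levy_process n (Z : R -> Omega -> 'cV[R]_n) : Prop :=
  [/\ cadlag Z /\ adapted F Z,
      {ae P, forall w, Z 0 w = 0},
      forall s t : R, 0 <= s -> s <= t -> forall A B, F s A ->
        @borel 'cV[R]_n B ->
        P (A `&` [set w | B (Z t w - Z s w)]) =
        (P A * P [set w | B (Z t w - Z s w)%R])%E &
      forall s h : R, 0 <= s -> 0 <= h -> forall B, @borel 'cV[R]_n B ->
        P [set w | B (Z (s + h) w - Z s w)] = P [set w | B (Z h w - Z 0 w)]].

Definition characteristic_exponent n (Z : R -> Omega -> 'cV[R]_n)
    (psi : 'cV[R]_n -> R[i]) : Prop :=
  forall (t : R) eta, 0 <= t ->
    cexpectation P (fun w => cexp ('i * (dot (Z t w) eta)%:C)) =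
    cexp (- (t%:C * psi eta)).

Definition borel_space d : measurableType _ :=
  g_sigma_algebraType (@open 'cV[R]_d).

Definition Obar d : measurableType _ := (borel_space d * Omega)%type.

Definition Pbar d (x : 'cV[R]_d) : {measure set (Obar d) -> \bar R} :=
  (dirac (x : borel_space d) \x P)%E.

Definition Fbar d : R -> set_system (Obar d) := fun t =>
  \bigcap_(u in [set u | t < u])
    <<s [set B `*` C | B in @borel 'cV[R]_d & C in F u] >>.

(* Under each Pbar x, X solves dX = Phi(X_-) dZ, X_0 = x, with I j k a version
   of the integral of Phi(X_-)^{jk} with respect to Z^{(k)}. *)
Definition sde_solution d n (Z : R -> Omega -> 'cV[R]_n)
    (Phi : 'cV[R]_d -> 'M[R]_(d, n)) (X : R -> Obar d -> 'cV[R]_d) : Prop :=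
  [/\ cadlag X, adapted (@Fbar d) X &
      forall x, exists2 I : 'I_d -> 'I_n -> R -> Obar d -> R,
        forall j k, is_stochastic_integral (Pbar x) (@Fbar d)
          (fun t w => Phi (left_limit X t w) j k)
          (fun t w => Z t w.2 k ord0) (I j k) &
        {ae Pbar x, forall w, forall t : R, 0 <= t -> forall j,
          X t w j ord0 = x j ord0 + \sum_k I j k t w}].

Definition exit_time d (X : R -> Obar d -> 'cV[R]_d) (x : 'cV[R]_d) (r : R) :
    Obar d -> \bar R :=
  fun w => ereal_inf [set t%:E | t in
    [set t : R | 0 <= t /\ r < frobenius (X t w - x)]].

Definition stopped d (X : R -> Obar d -> 'cV[R]_d) (sigma : Obar d -> \bar R) :
    R -> Obar d -> 'cV[R]_d :=
  fun t w => X (fine (Order.min t%:E (sigma w))) w.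

Definition has_symbol d (X : R -> Obar d -> 'cV[R]_d)
    (p : 'cV[R]_d -> 'cV[R]_d -> R[i]) : Prop :=
  forall x xi (r : R), 0 < r ->
    - cexpectation (Pbar x) (fun w =>
        (cexp ('i * (dot (stopped X (exit_time X x r) t w - x) xi)%:C) - 1)
          / t%:C) @[t --> 0^'+] --> (p x xi : R[i]^o).

End levy_sde.

(* Main.v *)
Require Import Defs.
From mathcomp Require Import all_boot all_order all_algebra complex.
From mathcomp Require Import all_classical all_reals all_analysis.
From mathcomp Require Import measurable_realfun.
From mathcomp Require Import ring lra.
Import Order.TTheory GRing.Theory Num.Theory.
Import numFieldNormedType.Exports.

Set Implicit Arguments.
Unset Strict Implicit.
Unset Printing Implicit Defensive.

Local Open Scope classical_set_scope.
Local Open Scope ring_scope.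
Local Open Scope complex_scope.

(* The coefficients can be frozen along deterministic grids, which avoids Ito's
   formula and the Levy-Ito decomposition.  Approximate Phi(X_-), up to the exit
   time sigma from the ball, by simple processes.  For these, the stopped
   integral is a limit of sums Y_N = sum_(k < N) G_k (Z_(t_(k+1)) - Z_(t_k)) over
   a regular grid of [0, t], where G_k is F_(t_k)-measurable and is either zero
   or made of values of Phi on the ball.  As the increments are independent of
   the past,
     E exp(i xi.Y_(k+1)) = E (exp(i xi.Y_k) exp(- (t/N) psi(G_k^T xi))),
   and replacing psi(G_k^T xi) by psi(Phi(x)^T xi) costs at most (t/N) e unless
   X left a small ball around x before t.  Hence, for a constant C,
     |E exp(i xi.(X^sigma_t - x)) - exp(- t psi(Phi(x)^T xi))|
       <= t (e + C P(X leaves the small ball before t)),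
   which is o(t) by right continuity of X at 0. *)

(** * Measurability with respect to a sub-sigma-algebra *)

(** Three obstacles shape the details. The exponent [psi] is given only through [exp(- t psi)], and
    a single time [t] determines it only up to multiples of [2 pi i / t]; its local boundedness and
    continuity are obtained by using all small times at once, which fixes the branch of the
    logarithm. The stochastic integral is known only as a ucp limit along simple predictable
    processes, and a path with jumps is not approximated uniformly along deterministic partitions.
    So the integrand is sampled at the random times at which it has moved by more than a tolerance,
    and only then is the integral of the simple process discretised on a regular grid, where
    independence of increments applies. Hence the order of limits: grid first, simple approximation
    second, [t] to 0 last. Finally, the filtration need not be complete, so hitting times and
    suprema are reduced to rational times by one-sided continuity of the paths. *)

Section sub_sigma_algebra.
Context {R : realType} {T : pointedType}.
Implicit Types (G : set_system T) (f : T -> R).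

(** Passing through the type generated by [G] gives access to the closure properties of
    [measurable_fun]. When [G] is a sigma-algebra, this is the usual condition on preimages. *)
Definition gmeasurable_fun G f :=
  measurable_fun [set: g_sigma_algebraType G] (f : g_sigma_algebraType G -> R).

Lemma gmeasurable_funP G f : sigma_algebra setT G ->
  gmeasurable_fun G f <-> (forall B, measurable B -> G (f @^-1` B)).
Proof.
move=> sG; have GE := measurable_g_measurableTypeE sG; split.
  by move=> mf B mB; rewrite -GE -[X in measurable X]setTI; exact: mf.
by move=> mf _ B mB; rewrite setTI GE; exact: mf.
Qed.

Lemma gmeasurable_funS G G' f : sigma_algebra setT G -> sigma_algebra setT G' ->
  G `<=` G' -> gmeasurable_fun G f -> gmeasurable_fun G' f.
Proof.
move=> sG sG' GG' /(gmeasurable_funP _ sG) mf.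
by apply/gmeasurable_funP => // B mB; exact/GG'/mf.
Qed.

Lemma borelE : @borel R = measurable.
Proof.
rewrite /borel; apply/seteqP; split.
  apply: smallest_sub; first exact: sigma_algebra_measurable.
  by move=> U /open_measurable.
have -> : @measurable _ R = <<s @RGenOpens.G R >>.
  exact: (RGenOpens.measurableE R).
apply: smallest_sub; first exact: smallest_sigma_algebra.
move=> U [a [b ->]]; apply: sub_sigma_algebra; exact: interval_open.
Qed.

Lemma borel_preimage (E E' : topologicalType) (g : E -> E') (B : set E') :
  continuous g -> borel B -> borel (g @^-1` B).
Proof.
move=> /continuousP cg.
suff : @borel E' `<=` image_set_system setT g (@borel E).
  by move=> /(_ B) + bB => /(_ bB); rewrite /image_set_system /= setTI.
apply: smallest_sub.
  by apply: sigma_algebra_image; exact: smallest_sigma_algebra.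
move=> U oU; rewrite /image_set_system /= setTI; apply: sub_sigma_algebra.
exact: cg.
Qed.

(** Reduces vector-valued processes to real functions: [g] will be a coordinate, an entry of [Phi],
    or the distance to the starting point. *)
Lemma measurable_wrt_comp (E : topologicalType) G (X : T -> E) (g : E -> R) :
  sigma_algebra setT G -> measurable_wrt G X -> continuous g ->
  gmeasurable_fun G (g \o X).
Proof.
move=> sG mX cg; apply/gmeasurable_funP => // B.
rewrite -borelE comp_preimage => mB; apply: (mX (g @^-1` B)).
exact: borel_preimage.
Qed.

Lemma measurable_wrtP G f : sigma_algebra setT G ->
  measurable_wrt G f <-> gmeasurable_fun G f.
Proof.
by move=> sG; rewrite gmeasurable_funP// /measurable_wrt borelE.
Qed.

Lemma gmeasurable_fun_cvg G (h : nat -> T -> R) f :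
  (forall m, gmeasurable_fun G (h m)) ->
  (forall w, h m w @[m --> \oo] --> f w) -> gmeasurable_fun G f.
Proof.
move=> mh hf.
by apply: (@measurable_fun_cvg _ (g_sigma_algebraType G) R setT h).
Qed.

Lemma gmeasurable_norm G f : gmeasurable_fun G f ->
  gmeasurable_fun G (fun w => `|f w|).
Proof. by move=> mf; apply: measurableT_comp mf; exact: normr_measurable. Qed.

Lemma gmeasurable_bool G (b : T -> bool) : sigma_algebra setT G ->
  G [set w | b w] -> gmeasurable_fun G (fun w => (b w)%:R).
Proof.
move=> sG Gb; have mb : G.-sigma.-measurable [set w | b w].
  by rewrite measurable_g_measurableTypeE.
rewrite /gmeasurable_fun (_ : (fun w => _) = \1_[set w | b w]).
  exact: measurable_indic.
by apply/funext => w; rewrite indicE mem_setE.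
Qed.

Lemma gmeasurable_le G (f g : T -> R) : sigma_algebra setT G ->
  gmeasurable_fun G f -> gmeasurable_fun G g -> G [set w | f w <= g w].
Proof.
move=> sG mf mg; rewrite -(measurable_g_measurableTypeE sG).
rewrite -[X in measurable X]setTI; exact: measurable_fun_ler.
Qed.

Lemma gmeasurable_lt G (f g : T -> R) : sigma_algebra setT G ->
  gmeasurable_fun G f -> gmeasurable_fun G g -> G [set w | f w < g w].
Proof.
move=> sG mf mg; rewrite -(measurable_g_measurableTypeE sG).
rewrite -[X in measurable X]setTI; exact: measurable_fun_ltr.
Qed.

End sub_sigma_algebra.

(** * Filtrations and stopping times *)

Section filtrations.
Context {R : realType} {dT : measure_display} {T : measurableType dT}.
Variable F : R -> set_system T.
Hypothesis hF : filtration F.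

Lemma filtration_sigma t : 0 <= t -> sigma_algebra setT (F t).
Proof. by case: hF => + _ _ _; exact. Qed.

Lemma filtration_measurableE t : 0 <= t -> (F t).-sigma.-measurable = F t.
Proof. by move=> /filtration_sigma/measurable_g_measurableTypeE. Qed.

Lemma filtrationS s t : 0 <= s -> s <= t -> F s `<=` F t.
Proof. by case: hF => _ _ + _; exact. Qed.

Lemma filtration_measurable t : 0 <= t -> F t `<=` measurable.
Proof. by case: hF => _ + _ _; exact. Qed.

Lemma filtration_right t A : 0 <= t -> (forall u, t < u -> F u A) -> F t A.
Proof. by move=> t0 FA; case: hF => _ _ _ /(_ t t0); apply => u; exact: FA. Qed.

Lemma gmeasurable_fun_le s t (f : T -> R) : 0 <= s -> s <= t ->
  gmeasurable_fun (F s) f -> gmeasurable_fun (F t) f.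
Proof.
move=> s0 st; apply: gmeasurable_funS.
- exact: filtration_sigma.
- by apply: filtration_sigma; exact: le_trans st.
- exact: filtrationS.
Qed.

Lemma gmeasurable_fun_measurable t (f : T -> R) : 0 <= t ->
  gmeasurable_fun (F t) f -> measurable_fun setT f.
Proof.
move=> t0 /gmeasurable_funP mf _ B mB; rewrite setTI.
by apply: (filtration_measurable t0); apply: mf => //; exact: filtration_sigma.
Qed.

(** The form in which right continuity of paths enters: a strict inequality that holds at time [s]
    persists for a short while after [s]. *)
Definition right_open (D : R -> set T) :=
  forall w s, 0 <= s -> D s w -> \forall v \near s^'+, D v w.

(** If [D] holds at some [s < u], it also holds at a rational time between [s] and [u], so the
    uncountable union over [s] is a countable one. The strict bound [s < u] leaves room for that
    rational. *)
Lemma entry_measurable (D : R -> set T) u : 0 <= u -> right_open D ->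
  (forall s, 0 <= s -> s < u -> F s (D s)) ->
  F u [set w | exists s, [/\ 0 <= s, s < u & D s w]].
Proof.
move=> u0 oD FD.
rewrite (_ : [set w | _] = \bigcup_(q : rat)
   (if (0 <= ratr q :> R) && (ratr q < u) then D (ratr q) else set0)).
  rewrite -filtration_measurableE//; apply: bigcupT_measurable_rat => q.
  case: ifPn => [/andP[q0 qu]|_]; last exact: measurable0.
  rewrite filtration_measurableE//; apply: (filtrationS q0 (ltW qu)).
  exact: FD.
apply/seteqP; split => w /=.
- move=> [s [s0 su Dsw]].
  have [/= e e0 De] := oD _ _ s0 Dsw.
  have [|q] := @rat_in_itvoo _ s (Num.min u (s + e)).
    by rewrite lt_min su ltrDl.
  rewrite in_itv/= lt_min => /andP[sq /andP[qu qe]].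
  exists q => //; rewrite (ltW (le_lt_trans s0 sq)) qu; apply: De => //=.
  by rewrite ltr0_norm ?subr_lt0// opprB ltrBlDl.
- move=> [q _]; case: ifPn => // /andP[q0 qu] Dq; by exists (ratr q).
Qed.

(* Cutting off at [c] keeps the set nonempty, so that [inf] is no junk value. *)
Definition hit (D : R -> set T) (c : R) (w : T) : R :=
  inf ([set s | 0 <= s /\ D s w] `|` [set c]).

Section hit.
Variables (D : R -> set T) (c : R).
Hypothesis c0 : 0 <= c.

Let S w := [set s | 0 <= s /\ D s w] `|` [set c].

Let S_lb w : lbound (S w) 0.
Proof. by move=> s [[]|->]. Qed.

Let S_has w : has_inf (S w).
Proof. by split; [exists c; right|exists 0; exact: S_lb]. Qed.

Lemma hit_ge0 w : 0 <= hit D c w.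
Proof. by apply: lb_le_inf; [exists c; right|exact: S_lb]. Qed.

Lemma hit_le w : hit D c w <= c.
Proof. by apply: ge_inf; [exists 0; exact: S_lb|right]. Qed.

Lemma hit_le_in w s : 0 <= s -> D s w -> hit D c w <= s.
Proof. by move=> s0 Ds; apply: ge_inf; [exists 0; exact: S_lb|left]. Qed.

Lemma hit_notin w s : 0 <= s -> s < hit D c w -> ~ D s w.
Proof. by move=> s0 + Ds; rewrite ltNge hit_le_in. Qed.

(** The inequality must be strict: the infimum need not be attained, so [hit D c w <= u] has no such
    description. *)
Lemma hit_ltP w u : hit D c w < u <->
  c < u \/ exists s, [/\ 0 <= s, s < u & D s w].
Proof.
split.
  move=> /(inf_lt (S_has w).1)[s [[s0 Ds]|->] su]; last by left.
  by right; exists s.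
move=> [cu|[s [s0 su Ds]]]; first exact: le_lt_trans (hit_le w) cu.
exact: le_lt_trans (hit_le_in s0 Ds) su.
Qed.

(** For [v > u], the event that the hitting time is at most [u] is the intersection of the events
    that it is below [u + (v - u) / (k + 1)], all of which lie in [F v]. Right continuity of the
    filtration then lets [v] decrease to [u]. *)
Lemma hit_stopping : right_open D -> (forall s, 0 <= s -> F s (D s)) ->
  stopping_time F (hit D c).
Proof.
move=> oD FD; split; first exact: hit_ge0.
move=> u u0; apply: filtration_right => // v uv.
have vu0 : 0 < v - u by rewrite subr_gt0.
have v0 : 0 <= v by rewrite (le_trans u0)// ltW.
rewrite (_ : [set w | _] = \bigcap_k
    [set w | hit D c w < u + (v - u) / k.+1%:R]).
  rewrite -filtration_measurableE//; apply: bigcapT_measurable => k.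
  rewrite filtration_measurableE//.
  have vk0 : 0 <= u + (v - u) / k.+1%:R.
    by rewrite addr_ge0// divr_ge0// ltW.
  apply: (filtrationS vk0).
    by rewrite -lerBrDl ler_pdivrMr// ler_peMr// ?ler1n// ltW.
  (* Beyond the cutoff [c] the event is certain; below it, the event is an entry before a fixed
     time. *)
  have [cu|uc] := ltP c (u + (v - u) / k.+1%:R).
    rewrite (_ : [set w | _] = setT).
      by rewrite -filtration_measurableE//; exact: measurableT.
    by apply/seteqP; split => // w _ /=; apply/hit_ltP; left.
  rewrite (_ : [set w | _] = [set w | exists s,
     [/\ 0 <= s, s < u + (v - u) / k.+1%:R & D s w]]).
    by apply: entry_measurable => // s s0 _; exact: FD.
  apply/seteqP; split => w /= => [/hit_ltP[|//]|]; first by rewrite ltNge uc.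
  by move=> H; apply/hit_ltP; right.
apply/seteqP; split => w /=.
  by move=> hu k _ /=; rewrite (le_lt_trans hu)// ltrDl divr_gt0.
move=> H; apply/ler_addgt0Pr => e e0.
have [k] := ltr_add_invr (y := 0) (x := e / (v - u)) (divr_gt0 e0 vu0).
rewrite add0r => ke.
rewrite (le_trans (ltW (H k I)))// lerD2l mulrC -ler_pdivlMr//.
exact: ltW.
Qed.

End hit.

(** * Sums along regular grids and values at stopping times *)

Definition grid (c : R) (N k : nat) : R := c * k%:R / N.+1%:R.

Lemma grid_ge0 c N k : 0 <= c -> 0 <= grid c N k.
Proof. by move=> c0; rewrite /grid divr_ge0// mulr_ge0. Qed.

Lemma le_grid c N j k : 0 <= c -> (j <= k)%N -> grid c N j <= grid c N k.
Proof.
by move=> c0 jk; rewrite /grid ler_wpM2r// ler_wpM2l// ler_nat.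
Qed.

Lemma grid0 c N : grid c N 0 = 0.
Proof. by rewrite /grid mulr0 mul0r. Qed.

Lemma grid_last c N : grid c N N.+1 = c.
Proof. by rewrite /grid mulfK// pnatr_eq0. Qed.

Lemma grid_lt c N k : 0 < c -> (k < N.+1)%N -> grid c N k < c.
Proof.
by move=> c0 kN; rewrite /grid ltr_pdivrMr// ltr_pM2l// ltr_nat.
Qed.

(** The discretised integral of the indicator of times before [tau] against [V], with the indicator
    evaluated at left end points. *)
Definition grid_sum (c : R) (V : R -> R) (tau : R) (N : nat) : R :=
  \sum_(k < N.+1) (grid c N k < tau)%R%:R * (V (grid c N k.+1) - V (grid c N k)).

(** The sum telescopes up to the first grid point [v] that is not before [tau], which is at most one
    mesh width away. *)
Lemma grid_sumE c V tau N : 0 <= tau <= c -> exists2 v,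
  tau <= v <= tau + c / N.+1%:R & grid_sum c V tau N = V v - V 0.
Proof.
move=> /andP[tau0 tauc]; have c0 : 0 <= c by exact: le_trans tauc.
have : exists K, tau <= grid c N K by exists N.+1; rewrite grid_last.
move=> /ex_minnP[K tauK minK].
have KN : (K <= N.+1)%N by apply: minK; rewrite grid_last.
exists (grid c N K).
  rewrite tauK/=; case: K tauK minK KN => [|K] tauK minK KN.
    by rewrite grid0 addr_ge0// divr_ge0.
  have : grid c N K < tau.
    by rewrite ltNge; apply/negP => /minK; rewrite ltnn.
  rewrite {2}/grid -natr1 mulrDr mulr1 mulrDl -/(grid c N K) => ?.
  by rewrite lerD2r ltW.
rewrite /grid_sum -(big_mkord xpredT (fun k => (grid c N k < tau)%R%:R *
  (V (grid c N k.+1) - V (grid c N k)))) (big_cat_nat (n := K))//=.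
rewrite [X in _ + X]big_nat_cond [X in _ + X]big1 ?addr0; last first.
  move=> k /andP[/andP[Kk _] _]; rewrite ltNge (le_trans tauK) ?mul0r//.
  exact: le_grid.
rewrite big_nat_cond.
rewrite (eq_bigr (fun k => V (grid c N k.+1) - V (grid c N k))); last first.
  move=> k /andP[/andP[_ kK] _]; rewrite ltNge; case: leP => [/minK|_].
    by rewrite leqNgt kK.
  by rewrite mul1r.
by rewrite -big_nat_cond (telescope_sumr (fun k => V (grid c N k)))// grid0.
Qed.

Lemma grid_sum_cvg c (V : R -> R) tau : 0 <= tau <= c ->
  V v @[v --> tau^'+] --> V tau ->
  grid_sum c V tau N @[N --> \oo] --> V tau - V 0.
Proof.
move=> tc /cvgrPdist_le cV; apply/cvgrPdist_le => e e0.
have [d /= d0 Hd] := cV e e0.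
have c0 : 0 <= c by move: tc => /andP[]; exact: le_trans.
have cd : (fun N => c / N.+1%:R) @ \oo --> (0 : R).
  by rewrite -[X in _ --> X](mulr0 c); apply: cvgM; [exact: cvg_cst|exact: cvg_harmonic].
move/cvgrPdist_lt : cd => /(_ d d0) cd.
near=> N.
have cN : c / N.+1%:R < d.
  have : `|0 - c / N.+1%:R| < d by near: N.
  by rewrite sub0r normrN ger0_norm// divr_ge0.
have [v /andP[tauv vtau] ->] := grid_sumE V N tc.
have -> : V tau - V 0 - (V v - V 0) = V tau - V v by ring.
(* The filter [tau^'+] excludes [tau] itself, so a grid point that falls exactly on [tau] is treated
   apart. *)
move: tauv; rewrite le_eqVlt => /predU1P[<-|tauv].
  by rewrite subrr normr0 ltW.
apply: Hd => //=; rewrite ltr0_norm ?subr_lt0// opprB ltrBlDl.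
by rewrite (le_lt_trans vtau)// ltrD2l.
Unshelve. all: by end_near. Qed.

(* [grid_sum] only involves V at deterministic times, whence the measurability
   of V at a stopping time. *)
Lemma stopped_gmeasurable c (V : R -> T -> R) tau :
  (forall w s, 0 <= s -> V v w @[v --> s^'+] --> V s w) ->
  (forall s, 0 <= s -> gmeasurable_fun (F s) (V s)) ->
  stopping_time F tau -> 0 <= c ->
  gmeasurable_fun (F c) (fun w => V (Num.min (tau w) c) w).
Proof.
move=> rV mV [tau0 Ftau] c0; have sF := filtration_sigma c0.
rewrite (_ : (fun w => _) = (fun w =>
    (V (Num.min (tau w) c) w - V 0 w) + V 0 w)); last first.
  by apply/funext => w; rewrite subrK.
apply: measurable_funD; last exact: gmeasurable_fun_le (mV _ _).
apply: (gmeasurable_fun_cvg (h := fun N w =>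
    grid_sum c (V ^~ w) (Num.min (tau w) c) N)); last first.
  by move=> w; apply: grid_sum_cvg; [rewrite le_min tau0 c0 ge_min lexx orbT|
    apply: rV; rewrite le_min tau0].
move=> N; apply: measurable_sum => k.
have gc : grid c N k.+1 <= c.
  by rewrite -{2}(grid_last c N); exact: le_grid.
apply: measurable_funM; last first.
  apply: measurable_funB; apply: gmeasurable_fun_le (mV _ _) => //;
    rewrite ?grid_ge0// (le_trans _ gc)//; exact: le_grid.
have -> : (fun w => (grid c N k < Num.min (tau w) c)%R%:R) =
    (fun w => (~~ (tau w <= grid c N k) && (grid c N k < c))%R%:R :> R).
  by apply/funext => w; rewrite lt_min ltNge.
apply: gmeasurable_bool => //.
have [gck|] := ltP (grid c N k) c; last first.
  move=> _; rewrite (_ : [set w | _] = set0); last first.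
    by apply/seteqP; split => w //=; rewrite andbF.
  by rewrite -filtration_measurableE//; exact: measurable0.
rewrite (_ : [set w | _] = ~` [set w | tau w <= grid c N k]).
  rewrite -filtration_measurableE//; apply: measurableC.
  rewrite filtration_measurableE//.
  apply: (filtrationS (grid_ge0 N k c0) (ltW gck)).
  by apply: Ftau; exact: grid_ge0.
by apply/seteqP; split => w /=; rewrite andbT => /negP.
Qed.

(** On the event [tau <= t] the value at [tau] is the value at [min(tau, t)], which is measurable
    for [F t]. *)
Lemma stopped_value_measurable (V : R -> T -> R) tau :
  (forall w s, 0 <= s -> V v w @[v --> s^'+] --> V s w) ->
  (forall s, 0 <= s -> gmeasurable_fun (F s) (V s)) ->
  stopping_time F tau ->
  measurable_wrt (stopped_sigma_algebra F tau) (fun w => V (tau w) w).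
Proof.
move=> rV mV stau B bB t t0.
rewrite (_ : _ `&` _ = ((fun w => V (Num.min (tau w) t) w) @^-1` B) `&`
    [set w | tau w <= t]).
  rewrite -filtration_measurableE//; apply: measurableI;
    rewrite filtration_measurableE//; last by apply: stau.2.
  apply: (gmeasurable_funP _ (filtration_sigma t0)).1; last by rewrite -borelE.
  exact: stopped_gmeasurable.
by apply/seteqP; split => w /= [Vw tw]; split => //; move: Vw; rewrite min_l.
Qed.

(** This is [stopped_gmeasurable] for the deterministic process whose value at time [s] is [s]. *)
Lemma stopping_time_gmeasurable c tau : stopping_time F tau -> 0 <= c ->
  (forall w, tau w <= c) -> gmeasurable_fun (F c) tau.
Proof.
move=> stau c0 tauc.
have : gmeasurable_fun (F c) (fun w => Num.min (tau w) c).
  apply: (@stopped_gmeasurable c (fun s _ => s)) => //.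
    by move=> _ s _; apply: cvg_at_right_filter; exact: cvg_id.
  by move=> s s0; exact: measurable_cst.
by rewrite (_ : (fun w => _) = tau)//; apply/funext => w; rewrite min_l.
Qed.

(** * Random partitions along the oscillations of a path *)

Section oscillation.
Variables (V : R -> T -> R) (e c : R).
Hypothesis rV : forall w s, 0 <= s -> V v w @[v --> s^'+] --> V s w.
Hypothesis lV : forall w s, 0 < s -> cvg (V v w @[v --> s^'-]).
Hypothesis mV : forall s, 0 <= s -> gmeasurable_fun (F s) (V s).
Hypothesis e0 : 0 < e.
Hypothesis c0 : 0 <= c.

Definition osc_set (tau : T -> R) (s : R) : set T :=
  [set w | tau w <= s /\ e < `|V s w - V (tau w) w|].

(** The next time is the first at which the path is more than [e] away from its value at the current
    one, capped at the horizon [c]. Such a partition follows the jumps of the path, which no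
    deterministic one does. *)
Fixpoint osc_time (i : nat) : T -> R :=
  if i is j.+1 then hit (osc_set (osc_time j)) c else fun=> 0.

Lemma osc_time_ge0 i w : 0 <= osc_time i w.
Proof. by case: i => //= i; exact: hit_ge0. Qed.

Lemma osc_time_le i w : osc_time i w <= c.
Proof. by case: i => //= i; exact: hit_le. Qed.

Lemma osc_timeS i w : osc_time i w <= osc_time i.+1 w.
Proof.
apply: lb_le_inf; first by exists c; right.
by move=> s [[_ []//]|->]; exact: osc_time_le.
Qed.

Lemma osc_set_right_open tau : (forall w, 0 <= tau w) -> right_open (osc_set tau).
Proof.
move=> tau0 w s s0 [tws eV].
have : `|V v w - V (tau w) w| @[v --> s^'+] --> `|V s w - V (tau w) w|.
  by apply: cvg_norm; apply: cvgB; [exact: rV|exact: cvg_cst].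
move=> /cvgr_gt/(_ _ eV) H; near=> v; split; last by near: v.
by rewrite (le_trans tws)// ltW//; near: v; exact: nbhs_right_gt.
Unshelve. all: by end_near. Qed.

(** The value at [tau] is known at time [s] only where [tau <= s]; there it may be replaced by the
    value at [min(tau, s)]. *)
Lemma osc_set_measurable tau s : stopping_time F tau -> 0 <= s ->
  F s (osc_set tau s).
Proof.
move=> stau s0.
rewrite (_ : osc_set tau s = [set w | tau w <= s] `&`
   [set w | e < `|V s w - V (Num.min (tau w) s) w|]).
  rewrite -filtration_measurableE//; apply: measurableI;
    rewrite filtration_measurableE//; first exact: stau.2.
  apply: gmeasurable_lt; first exact: filtration_sigma.
    exact: measurable_cst.
  apply: gmeasurable_norm.
  by apply: measurable_funB; [exact: mV|exact: stopped_gmeasurable].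
by apply/seteqP; split => w [/= tw]; rewrite min_l.
Qed.

Lemma osc_time_stopping i : stopping_time F (osc_time i).
Proof.
elim: i => [|i IH] /=.
  split => // t t0; rewrite (_ : [set w | _] = setT).
    by rewrite -filtration_measurableE//; exact: measurableT.
  by apply/seteqP; split.
apply: hit_stopping => //; last by move=> s s0; exact: osc_set_measurable.
exact/osc_set_right_open/osc_time_ge0.
Qed.

Lemma osc_time_small i w s : osc_time i w <= s -> s < osc_time i.+1 w ->
  `|V s w - V (osc_time i w) w| <= e.
Proof.
move=> is_ si; rewrite leNgt; apply/negP => eV.
have s0 : 0 <= s by rewrite (le_trans _ is_)// osc_time_ge0.
exact: (hit_notin c0 s0 si).
Qed.

(** The strict inequality in [osc_set] may fail at the infimum itself, but right continuity yields
    the weak one there. The hypothesis excludes a time produced by the cutoff. *)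
Lemma osc_time_big i w : osc_time i.+1 w < c ->
  e <= `|V (osc_time i.+1 w) w - V (osc_time i w) w|.
Proof.
set t := osc_time i.+1 w => tc; rewrite leNgt; apply/negP => eV.
have t0 : 0 <= t by exact: osc_time_ge0.
have : `|V v w - V (osc_time i w) w| @[v --> t^'+] -->
    `|V t w - V (osc_time i w) w|.
  by apply: cvg_norm; apply: cvgB; [exact: rV|exact: cvg_cst].
move=> /cvgr_lt/(_ _ eV)[d /= d0 Hd].
(* This produces a time [s] in [[t, t + d)] at which the oscillation exceeds [e], although it is
   below [e] on that whole interval. *)
have : t < Num.min (t + d) c by rewrite lt_min ltrDl d0.
move=> /(hit_ltP _ c0 _ _).1 [|[s [s0 sd Dw]]].
  by rewrite ltNge ge_min lexx orbT.
move: sd; rewrite lt_min => /andP[sd sc].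
have : t <= s.
  exact: (hit_le_in c0 s0 Dw).
have [_ Ds] := Dw.
rewrite le_eqVlt => /predU1P[ts|ts].
  by move: Ds; rewrite -ts ltNge (ltW eV).
have : `|V s w - V (osc_time i w) w| < e.
  by apply: Hd => //=; rewrite ltr0_norm ?subr_lt0// opprB ltrBlDl.
by rewrite ltNge (ltW Ds).
Qed.

(** Otherwise the times increase to some [L], and the left limit at [L] forces consecutive values
    together, while [osc_time_big] keeps them [e] apart. *)
Lemma osc_time_finite w : exists i, osc_time i w = c.
Proof.
apply: contrapT => /forallNP tc.
have {}tc i : osc_time i w < c.
  by rewrite lt_neqAle osc_time_le andbT; apply/eqP; exact: tc.
set t := fun i => osc_time i w.
have ndt : nondecreasing_seq t by apply/nondecreasing_seqP => i; exact: osc_timeS.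
have ubt : has_ubound (range t) by exists c => _ [i _ <-]; exact: osc_time_le.
have := nondecreasing_cvgn ndt ubt; set L := sup _ => tL.
(* Strict growth keeps every time below [L], as the left limit requires; equal times would
   contradict [osc_time_big]. *)
have ti i : t i < t i.+1.
  rewrite lt_neqAle osc_timeS andbT; apply/eqP => titi.
  have := osc_time_big (tc i.+1); rewrite -[osc_time i.+1 w]/(t i.+1) -titi.
  by rewrite subrr normr0 leNgt e0.
have tiL i : t i < L.
  by rewrite (lt_le_trans (ti i))//; apply: ub_le_sup => //; exists i.+1.
have L0 : 0 < L by exact: le_lt_trans (tiL 0%N).
have /cvg_at_leftP/(_ t) := @lV w L L0; move=> /(_ (conj tiL tL)) tl.
have tl1 : V (t n.+1) w @[n --> \oo] --> lim (V v w @[v --> L^'-]).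
  by rewrite (cvg_shiftS (fun n => V (t n) w)).
have : `|V (t n.+1) w - V (t n) w| @[n --> \oo] --> (0 : R).
  rewrite -[X in _ --> X](@normr0 _ R) -[X in `|X|](subrr (lim (V v w @[v --> L^'-]))).
  by apply: cvg_norm; exact: cvgB.
move=> /cvgr_lt/(_ _ e0)[n _ /(_ n (leqnn n))] /=.
by rewrite ltNge osc_time_big.
Qed.

(** The value of [V] at a stopping time is measurable for the stopped sigma-algebra, and it stays
    [e]-close to the left limits of [V] up to and including the next oscillation time. *)
Definition osc_process (N : nat) : simple_process T := {|
  sp_size := N;
  sp_time := osc_time;
  sp_val0 := V 0;
  sp_val := fun i w => V (osc_time i w) w |}.

Lemma osc_process_predictable N : simple_predictable F (osc_process N).
Proof.
split => //=.
- by move=> i _ w; exact: osc_timeS.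
- by move=> i _; exact: osc_time_stopping.
- by apply/measurable_wrtP; [exact: filtration_sigma|exact: mV].
- by move=> i _; apply: stopped_value_measurable => //; exact: osc_time_stopping.
Qed.

Lemma osc_time_homo w : {homo (fun i => osc_time i w) : i j / (i <= j)%N >-> i <= j}.
Proof. by apply/nondecreasing_seqP => i; exact: osc_timeS. Qed.

Lemma sp_process_osc N w t i : 0 < t -> (i < N)%N ->
  osc_time i w < t -> t <= osc_time i.+1 w ->
  sp_process (osc_process N) t w = V (osc_time i w) w.
Proof.
move=> t0 iN it ti; rewrite /sp_process gt_eqF// mulr0 add0r/=.
rewrite (bigD1 (Ordinal iN))//= it ti mulr1 big1 ?addr0// => -[j jN]/= ji.
have [ij|] := ltnP i j.
  rewrite [osc_time j w < t]ltNge (le_trans ti) ?mulr0//.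
  exact: (osc_time_homo w ij).
rewrite leq_eqVlt -(inj_eq val_inj)/= in ji *; rewrite (negbTE ji)/= => ji'.
rewrite [t <= _](_ : _ = false) ?andbF ?mulr0//; apply/negbTE.
by rewrite -ltNge; exact: le_lt_trans (osc_time_homo w ji') it.
Qed.

(** For [t] in [(T_i, T_{i+1}]], the value [VL t] is a limit of values of [V] at times in
    [[T_i, t)], all within [e] of [V] at [T_i]. Time 0 is covered by the initial value and the
    convention on [VL]. *)
Lemma sp_process_osc_approx N (VL : R -> T -> R) w t :
  VL 0 w = V 0 w -> (forall s, 0 < s -> V v w @[v --> s^'-] --> VL s w) ->
  osc_time N w = c -> 0 <= t -> t <= c ->
  `|sp_process (osc_process N) t w - VL t w| <= e.
Proof.
move=> VL0 VLt TN t0 tc; move: t0; rewrite le_eqVlt => /predU1P[<-|t0].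
  rewrite VL0 /sp_process eqxx mulr1 big1 ?addr0 ?subrr ?normr0 1?ltW//.
  by move=> i _ /=; rewrite ltNge osc_time_ge0 mulr0.
have exi : exists i, t <= osc_time i w by exists N; rewrite TN.
have [[|i] ti mini] := ex_minnP exi; first by move: ti; rewrite leNgt t0.
have it : osc_time i w < t by rewrite ltNge; apply/negP => /mini; rewrite ltnn.
have iN : (i < N)%N by apply: mini; rewrite TN.
rewrite (sp_process_osc t0 iN it ti) distrC.
have : `|V v w - V (osc_time i w) w| @[v --> t^'-] -->
    `|VL t w - V (osc_time i w) w|.
  by apply: cvg_norm; apply: cvgB; [exact: VLt|exact: cvg_cst].
move=> cV; rewrite -(cvg_lim _ cV)//; apply: limr_le.
  by apply/cvg_ex; eexists; exact: cV.
near=> v; apply: osc_time_small.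
  by near: v; exact: nbhs_left_ge.
by rewrite (lt_le_trans _ ti)//; near: v; exact: nbhs_left_lt.
Unshelve. all: by end_near. Qed.

End oscillation.

End filtrations.

(** * Measurability of suprema over time intervals *)

Section sup_measurable.
Context {R : realType} {dT : measure_display} {T : measurableType dT}.

Lemma lt_ereal_sup_itv (f : R -> R) (t eps : R) :
  (eps%:E < ereal_sup [set (f s)%:E | s in [set` `[0, t]%R]])%E <->
  exists s, [/\ 0 <= s, s <= t & eps < f s].
Proof.
split.
  move=> /ereal_sup_gt[_ [s + <-]]; rewrite /= in_itv/= => /andP[s0 st].
  by rewrite lte_fin => ?; exists s.
move=> [s [s0 st fs]]; apply: (@lt_le_trans _ _ (f s)%:E); rewrite ?lte_fin//.
by apply: ereal_sup_ubound; exists s => //=; rewrite in_itv/= s0.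
Qed.

(** With this constant filtration, the results on entry and stopping apply to plain
    measurability. *)
Lemma filtration_cst : filtration (fun _ : R => @measurable _ T).
Proof.
split=> [t _|t _|s t _ _|t t0 A] //; first exact: sigma_algebra_measurable.
by move=> /(_ (t + 1)); apply; rewrite /= ltrDl ltr01.
Qed.

(** Exceeding [eps] before [t] is an entry event. The end point [t] is added by hand, since the
    rationals that approximate it from the right lie outside the interval. *)
Lemma measurable_sup_right (A : R -> T -> R) (t eps : R) : 0 <= t ->
  (forall s, 0 <= s -> measurable_fun setT (A s)) ->
  (forall w s, 0 <= s -> A v w @[v --> s^'+] --> A s w) ->
  measurable [set w | (eps%:E < ereal_sup
    [set `|A s w|%:E | s in [set` `[0, t]%R]])%E].
Proof.
move=> t0 mA rA; pose D s := [set w | eps < `|A s w|].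
have mD s : 0 <= s -> measurable (D s).
  move=> s0; rewrite -[X in measurable X]setTI.
  apply: measurable_fun_ltr => //; apply: measurableT_comp => //; exact: mA.
rewrite (_ : [set w | _] =
    [set w | exists s, [/\ 0 <= s, s < t & D s w]] `|` D t).
  apply: measurableU; last exact: mD.
  apply: (entry_measurable filtration_cst) => //.
    move=> w s s0 Ds; have : `|A v w| @[v --> s^'+] --> `|A s w|.
      by apply: cvg_norm; exact: rA.
    by move/cvgr_gt; exact.
  by move=> s s0 _; exact: mD.
apply/seteqP; split => w /=.
  move=> /lt_ereal_sup_itv[s [s0 + As]]; rewrite le_eqVlt => /predU1P[<-|st].
    by right.
  by left; exists s.
move=> [[s [s0 st As]]|At]; apply/lt_ereal_sup_itv.
  by exists s; split => //; exact: ltW.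
by exists t.
Qed.

(** Reversing time by [s |-> t - s] turns left continuity into right openness. The constraint
    [s < t] keeps the reversed time positive; time 0 is added separately. *)
Lemma measurable_sup_left (A : R -> T -> R) (t eps : R) : 0 <= t ->
  (forall s, 0 <= s -> measurable_fun setT (A s)) ->
  (forall w s, 0 < s -> A v w @[v --> s^'-] --> A s w) ->
  measurable [set w | (eps%:E < ereal_sup
    [set `|A s w|%:E | s in [set` `[0, t]%R]])%E].
Proof.
move=> t0 mA lA; pose D s := [set w | eps < `|A s w|].
have mD s : 0 <= s -> measurable (D s).
  move=> s0; rewrite -[X in measurable X]setTI.
  apply: measurable_fun_ltr => //; apply: measurableT_comp => //; exact: mA.
rewrite (_ : [set w | _] =
    [set w | exists s, [/\ 0 <= s, s < t & [set w | s < t /\ D (t - s) w] w]]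
    `|` D 0).
  apply: measurableU; last exact: mD.
  apply: (@entry_measurable _ _ _ _ filtration_cst
    (fun s => [set w | s < t /\ D (t - s) w])) => //.
    move=> w s s0 [st Ds].
    have ts0 : 0 < t - s by rewrite subr_gt0.
    have : `|A v w| @[v --> (t - s)^'-] --> `|A (t - s) w|.
      by apply: cvg_norm; exact: lA.
    move=> /cvgr_gt/(_ _ Ds)[d /= d0 Hd].
    near=> v; have sv : s < v by near: v; exact: nbhs_right_gt.
    split; first by near: v; exact: nbhs_right_lt.
    apply: Hd => /=; last by rewrite ltrD2l ltrN2.
    rewrite (_ : t - s - (t - v) = v - s); last by ring.
    rewrite gtr0_norm ?subr_gt0// ltrBlDl; near: v.
    by apply: nbhs_right_lt; rewrite ltrDl.
  move=> s s0 st; rewrite (_ : [set w | _] = D (t - s)).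
    by apply: mD; rewrite subr_ge0 ltW.
  by apply/seteqP; split => w /= [].
apply/seteqP; split => w /=.
  move=> /lt_ereal_sup_itv[s []]; rewrite le_eqVlt => /predU1P[<-|s0] st As.
    by right.
  left; exists (t - s); split; rewrite ?subr_ge0 ?ltrBlDl ?ltrDr//.
  by rewrite subKr; split => //; rewrite ltrBlDl ltrDr.
move=> [[s [s0 _ [st As]]]|At]; apply/lt_ereal_sup_itv.
  by exists (t - s); split; [rewrite subr_ge0 ltW|rewrite gerBl|exact: As].
by exists 0.
Unshelve. all: by end_near. Qed.

End sup_measurable.

Lemma cvg_sumr {R : realType} (T I : Type) (G : set_system T) {FG : Filter G}
    (r : seq I) (f : I -> T -> R) (l : I -> R) :
  (forall i, f i x @[x --> G] --> l i) ->
  (\sum_(i <- r) f i x) @[x --> G] --> \sum_(i <- r) l i.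
Proof.
move=> fl; elim: r => [|i r IH].
  by rewrite big_nil; under eq_fun do rewrite big_nil; exact: cvg_cst.
by rewrite big_cons; under eq_fun do rewrite big_cons; exact: cvgD.
Qed.

(** The intervals [(T_i, T_{i+1}]] are open on the left and closed on the right, so their indicators
    are constant just before any positive time. *)
Lemma sp_process_left {R : realType} (T : Type) (K : simple_process T) w (s : R) :
  0 < s -> sp_process K v w @[v --> s^'-] --> sp_process K s w.
Proof.
move=> s0; apply: cvgD.
  apply: cvgM; first exact: cvg_cst.
  apply: (@cvg_near_cst R R); near=> v.
  have v0 : 0 < v by near: v; exact: nbhs_left_gt.
  by rewrite !gt_eqF.
apply: cvg_sumr => i; apply: cvgM; first exact: cvg_cst.
have lt_near a : \forall v \near s^'-, (a < v) = (a < s).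
  have [as_|sa] := ltP a s; near=> v.
    by rewrite (_ : a < v)//; near: v; exact: nbhs_left_gt.
  by apply/negbTE; rewrite -leNgt (le_trans _ sa)//; near: v; exact: nbhs_left_le.
apply: (@cvg_near_cst R R); near=> v.
congr ((_ && _)%:R); first by near: v; exact: lt_near.
by rewrite !leNgt; congr (~~ _); near: v; exact: lt_near.
Unshelve. all: by end_near. Qed.

(** * Simple predictable approximation of caglad processes *)

Section ucp_approximation.
Context {R : realType} {dT : measure_display} {T : measurableType dT}.
Variables (mu : {measure set T -> \bar R}) (F : R -> set_system T).
Hypothesis muT : (mu setT < +oo)%E.
Hypothesis hF : filtration F.

(** Continuity from above of a finite measure: the events decrease, and their intersection is empty
    by [osc_time_finite]. *)
Lemma osc_time_cvg_mu (V : R -> T -> R) (e c : R) :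
  (forall w s, 0 <= s -> V v w @[v --> s^'+] --> V s w) ->
  (forall w s, 0 < s -> cvg (V v w @[v --> s^'-])) ->
  (forall s, 0 <= s -> gmeasurable_fun (F s) (V s)) ->
  0 < e -> 0 <= c ->
  mu [set w | osc_time V e c N w < c] @[N --> \oo] --> 0%E.
Proof.
move=> rV lV mV e0 c0.
have mE N : measurable [set w | osc_time V e c N w < c].
  apply: (filtration_measurable hF c0).
  apply: gmeasurable_lt; first exact: (filtration_sigma hF).
    apply: (stopping_time_gmeasurable hF) => //.
      exact: (osc_time_stopping hF).
    exact: osc_time_le.
  exact: measurable_cst.
rewrite -[X in _ --> X](measure0 mu).
rewrite -(_ : \bigcap_N [set w | osc_time V e c N w < c] = set0).
  apply: nonincreasing_cvg_mu => //.
  - by rewrite (le_lt_trans _ muT)// le_measure// inE.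
  - exact: bigcapT_measurable.
  - move=> m n mn; apply/subsetPset => w /=; apply: le_lt_trans.
    exact: osc_time_homo.
rewrite -subset0 => w H; have [i Ti] := osc_time_finite rV lV e0 c0 w.
by have /= := H i I; rewrite Ti ltxx.
Qed.

(** Besides the convergence, the statement records that the values are values of [V] itself and that
    the partition eventually covers any [[0, t]] with high probability. Both are needed to control
    the exponent at the sampled coefficients. *)
Lemma ucp_approximation (V VL : R -> T -> R) :
  (forall w s, 0 <= s -> V v w @[v --> s^'+] --> V s w) ->
  (forall w s, 0 < s -> V v w @[v --> s^'-] --> VL s w) ->
  (forall w s, 0 < s -> VL v w @[v --> s^'-] --> VL s w) ->
  (forall w, VL 0 w = V 0 w) ->
  (forall s, 0 <= s -> gmeasurable_fun (F s) (V s)) ->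
  (forall s, 0 <= s -> gmeasurable_fun (F s) (VL s)) ->
  exists K : nat -> simple_process T,
    [/\ forall m, simple_predictable F (K m),
        cvg_ucp mu (fun m => sp_process (K m)) VL,
        forall m i w, sp_val (K m) i w = V (sp_time (K m) i w) w,
        forall m w, {homo (fun i => sp_time (K m) i w) : i j / (i <= j)%N >-> i <= j} &
        forall t, mu [set w | sp_time (K m) (sp_size (K m)) w <= t]
          @[m --> \oo] --> 0%E].
Proof.
move=> rV VVL lVL VL0 mV mVL.
have lV w s : 0 < s -> cvg (V v w @[v --> s^'-]).
  by move=> s0; apply/cvg_ex; exists (VL s w); exact: VVL.
have /choice[N HN] : forall m, exists N,
    (mu [set w | osc_time V m.+1%:R^-1 m.+1%:R N w < m.+1%:R]%R
      < m.+1%:R^-1%:E)%E.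
  move=> m.
  have := @osc_time_cvg_mu V m.+1%:R^-1 m.+1%:R rV lV mV.
  rewrite invr_gt0 ltr0n ler0n => /(_ isT isT).
  have e0 : (0 < m.+1%:R^-1%:E :> \bar R)%E by rewrite lte_fin invr_gt0.
  move=> /(_ [set x | (x < m.+1%:R^-1%:E)%E] (open_ereal_lt' e0))[N _ HN].
  by exists N; exact: (HN N (leqnn N)).
(* A single index drives three parameters: tolerance [1 / (m + 1)], horizon [m + 1], and enough
   steps to miss the horizon with measure below [1 / (m + 1)]. *)
pose K m := osc_process V m.+1%:R^-1 m.+1%:R (N m).
have stop m i : stopping_time F (osc_time V m.+1%:R^-1 m.+1%:R i).
  by apply: (osc_time_stopping hF) => //.
have mtime m i : gmeasurable_fun (F m.+1%:R) (osc_time V m.+1%:R^-1 m.+1%:R i).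
  by apply: (stopping_time_gmeasurable hF) => //; exact: osc_time_le.
have mlow m : measurable [set w | osc_time V m.+1%:R^-1 m.+1%:R (N m) w < m.+1%:R].
  apply: (@filtration_measurable _ _ _ _ hF m.+1%:R) => //.
  apply: gmeasurable_lt; [exact: (filtration_sigma hF)|exact: mtime|exact: measurable_cst].
have inv0 : (fun m => (m.+1%:R^-1%:E : \bar R)) @ \oo --> 0%E.
  by apply: cvg_EFin; [exact: nearW|exact: cvg_harmonic].
exists K; split.
- by move=> m; apply: (osc_process_predictable hF) => //; rewrite invr_gt0.
- move=> t eps t0 eps0.
  apply: (@squeeze_cvge _ _ _ _ (cst 0%E) _ (fun m => m.+1%:R^-1%:E)); [|exact: cvg_cst|exact: inv0].
  near=> m; rewrite measure_ge0/= (le_trans _ (ltW (HN m)))// le_measure ?inE//.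
    apply: measurable_sup_left => //; last first.
      by move=> w s s0; apply: cvgB; [exact: sp_process_left|exact: lVL].
    move=> s s0; apply: measurable_funB; last first.
      by apply: (gmeasurable_fun_measurable hF s0); exact: mVL.
    rewrite /sp_process; apply: measurable_funD.
      apply: measurable_funM => //.
      by apply: (gmeasurable_fun_measurable hF (lexx 0)); exact: mV.
    apply: measurable_sum => i.
    apply: (@gmeasurable_fun_measurable _ _ _ _ hF m.+1%:R) => //.
    apply: measurable_funM.
      have := stopped_gmeasurable hF rV mV (stop m i) (ler0n _ m.+1).
      congr gmeasurable_fun; apply/funext => w.
      by rewrite min_l// osc_time_le.
    apply: gmeasurable_bool; first exact: (filtration_sigma hF).
    rewrite (_ : [set w | _] = [set w | osc_time V m.+1%:R^-1 m.+1%:R i w < s]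
        `&` [set w | s <= osc_time V m.+1%:R^-1 m.+1%:R i.+1 w]).
      have mFm : 0 <= m.+1%:R :> R by [].
      rewrite -(filtration_measurableE hF mFm).
      apply: measurableI; rewrite (filtration_measurableE hF mFm).
        apply: gmeasurable_lt => //; first exact: (filtration_sigma hF).
        exact: measurable_cst.
      apply: gmeasurable_le => //; first exact: (filtration_sigma hF).
      exact: measurable_cst.
    by apply/seteqP; split => w; [move=> /andP[]|move=> [/= -> ->]].
  move=> w /= /lt_ereal_sup_itv[s [s0 st]]; rewrite ltNge => /negP H.
  rewrite ltNge; apply/negP => cT; apply: H.
  have TN : osc_time V m.+1%:R^-1 m.+1%:R (N m) w = m.+1%:R.
    by apply/eqP; rewrite eq_le cT osc_time_le.
  apply: (@le_trans _ _ m.+1%:R^-1); last first.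
    by apply: ltW; near: m; exact: (near_infty_natSinv_lt (PosNum eps0)).
  apply: sp_process_osc_approx => //.
    by move=> v v0; exact: VVL.
  rewrite (le_trans st)// -natr1 (@le_trans _ _ m%:R)// ?lerDl//.
  by near: m; exact: nbhs_infty_ger.
- by [].
- by move=> m w; exact: osc_time_homo.
- move=> t; apply: (@squeeze_cvge _ _ _ _ (cst 0%E) _ (fun m => m.+1%:R^-1%:E)); [|exact: cvg_cst|exact: inv0].
  near=> m; rewrite measure_ge0/= (le_trans _ (ltW (HN m)))// le_measure ?inE//.
    apply: (@filtration_measurable _ _ _ _ hF m.+1%:R) => //.
    apply: gmeasurable_le; [exact: (filtration_sigma hF)|exact: mtime|exact: measurable_cst].
  move=> w /= /le_lt_trans; apply; rewrite -natr1; apply: ltr_pwDr => //.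
  by near: m; exact: nbhs_infty_ger.
Unshelve. all: by end_near. Qed.

End ucp_approximation.

(** * Expectations and independence *)

Section expectation.
Context {R : realType} {dT : measure_display} {T : measurableType dT}.
Variable P : probability T R.

Lemma bounded_integrable (f : T -> R) (M : R) : measurable_fun setT f ->
  (forall w, `|f w| <= M) -> P.-integrable setT (EFin \o f).
Proof.
move=> mf fM; apply: measurable_bounded_integrable => //.
  by rewrite (le_lt_trans (probability_le1 _ _))// ltry.
exists M; split; first exact: num_real.
by move=> x Mx w _ /=; rewrite (le_trans (fM w))// ltW.
Qed.

Lemma integral_EFin_Rintegral (f : T -> R) (M : R) : measurable_fun setT f ->
  (forall w, `|f w| <= M) ->
  (\int[P]_w (f w)%:E = (\int[P]_w f w)%:E)%E.
Proof.
move=> mf fM; rewrite /Rintegral fineK//; apply: integrable_fin_num => //.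
exact: bounded_integrable mf fM.
Qed.

Lemma Rintegral_const (c : R) : \int[P]_(w in [set: T]) c = c.
Proof.
rewrite Rintegral_cst//.
rewrite -[RHS]mulr1; congr (_ * _).
exact: (congr1 fine (probability_setT P)).
Qed.

Lemma Rintegral_norm_le (f : T -> R) (M : R) : measurable_fun setT f ->
  (forall w, `|f w| <= M) -> `|\int[P]_w f w| <= M.
Proof.
move=> mf fM; have fi := bounded_integrable mf fM.
apply: (le_trans (le_normr_Rintegral _ fi)) => //.
rewrite -[leRHS]Rintegral_const.
apply: le_Rintegral => //.
  apply: (@bounded_integrable _ M); first exact: measurableT_comp.
  by move=> w; rewrite normr_id.
apply: (@bounded_integrable _ `|M|) => //.
Qed.

(** Splits an error into a small part [e] everywhere and a crude part [C] on a bad event [B]. It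
    serves both for replacing a coefficient and for replacing the simple integral by its limit. *)
Lemma Rintegral_dist_le (f g : T -> R) (M e C : R) (B : set T) :
  measurable_fun setT f -> measurable_fun setT g ->
  (forall w, `|f w| <= M) -> (forall w, `|g w| <= M) ->
  measurable B -> 0 <= C ->
  (forall w, `|f w - g w| <= e + C * \1_B w) ->
  `|\int[P]_w f w - \int[P]_w g w| <= e + C * fine (P B).
Proof.
move=> mf mg fM gM mB C0 fg.
rewrite -RintegralB//; [|exact: bounded_integrable fM|exact: bounded_integrable gM].
have mfg : measurable_fun setT (fun w => f w - g w) by exact: measurable_funB.
have fgi : P.-integrable setT (EFin \o (fun w => f w - g w)).
  apply: (@bounded_integrable _ (M + M)) => // w.
  by rewrite (le_trans (ler_normB _ _))// lerD.
apply: (le_trans (le_normr_Rintegral _ fgi)) => //.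
have Bi : P.-integrable setT (EFin \o \1_B).
  apply: (@bounded_integrable _ 1); first exact: measurable_indic.
  by move=> w; rewrite indicE ger0_norm// lern1 leq_b1.
have CBi : P.-integrable setT (EFin \o (fun w => C * \1_B w)).
  apply: (@bounded_integrable _ C).
    by apply: measurable_funM => //; exact: measurable_indic.
  move=> w; rewrite normrM ger0_norm// indicE ger0_norm// ler_piMr// lern1 leq_b1 //.
have ei : P.-integrable setT (EFin \o (fun=> e)).
  by apply: (@bounded_integrable _ `|e|).
have -> : e + C * fine (P B) = \int[P]_w (e + C * \1_B w).
  rewrite RintegralD// RintegralZl// Rintegral_const.
  by rewrite /Rintegral integral_indic// setIT.
apply: le_Rintegral => //.
  apply: (@bounded_integrable _ (M + M)); first exact: measurableT_comp.
  by move=> w; rewrite normr_id (le_trans (ler_normB _ _))// lerD.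
have := integrableD measurableT ei CBi.
by apply: eq_integrable => // w _ /=; rewrite EFinD.
Qed.

Lemma ae_eq_Rintegral (f g : T -> R) : measurable_fun setT f ->
  measurable_fun setT g -> {ae P, forall w, f w = g w} ->
  \int[P]_w f w = \int[P]_w g w.
Proof.
move=> mf mg fg; congr fine; apply: ae_eq_integral => //.
- exact/measurable_EFinP.
- exact/measurable_EFinP.
- by move: fg; apply: filterS => w + _ => ->.
Qed.

(** * Freezing one of two independent variables *)

Section independence.
Variables (G : set_system T) (n : nat) (D : 'I_n -> T -> R).
Hypotheses (sG : sigma_algebra setT G) (GT : G `<=` measurable).
Hypothesis mD : forall i, measurable_fun setT (D i).

Definition tuple_of_fun (w : T) : n.-tuple R := [tuple D i w | i < n].

Lemma measurable_tuple_of_fun : measurable_fun setT tuple_of_fun.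
Proof.
apply/measurable_fun_tnthP => i.
rewrite (_ : _ \o _ = D i)//.
by apply/funext => w /=; rewrite tnth_mktuple.
Qed.

Hypothesis indep : forall A B, G A -> measurable B ->
  P (A `&` tuple_of_fun @^-1` B) = (P A * P (tuple_of_fun @^-1` B))%E.

(** The identity from [T] to [T1] is a random variable that carries exactly the information in
    [G]. *)
Let T1 : measurableType _ := g_sigma_algebraType G.

Let mid : measurable_fun [set: T] (id : T -> T1).
Proof.
by move=> _ B; rewrite setTI measurable_g_measurableTypeE//; exact: GT.
Qed.

Variables (f : T1 * n.-tuple R -> R) (M : R).
Hypotheses (mf : measurable_fun setT f) (fM : forall z, `|f z| <= M).

Let X1 : {mfun T >-> T1} := mfun_Sub (mem_set mid).
Let X2 : {mfun T >-> n.-tuple R} := mfun_Sub (mem_set measurable_tuple_of_fun).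

(** By independence, the joint law of the identity into [T1] and the tuple is the product of their
    laws, so Fubini's theorem integrates out the tuple with the first argument frozen. This replaces
    conditional expectation given [G]. *)
Lemma independent_fubini :
  measurable_fun [set: T] (fun w : T => \int[P]_v f (w, tuple_of_fun v)) /\
  \int[P]_(w in [set: T]) f (w, tuple_of_fun w) =
  \int[P]_(w in [set: T]) \int[P]_v f (w, tuple_of_fun v).
Proof.
pose m1 : probability T1 R := distribution P X1.
pose m2 : probability (n.-tuple R) R := distribution P X2.
have mpr : measurable_fun setT (fun w => (w, tuple_of_fun w) : T1 * n.-tuple R).
  exact: (measurable_fun_pair mid measurable_tuple_of_fun).
pose m' : {measure set (T1 * n.-tuple R) -> \bar R} :=
  distribution P (mfun_Sub (mem_set mpr)).
have mE A : measurable A -> (m1 \x m2)%E A = m' A.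
  apply: product_measure_unique => B C mB mC.
  rewrite /m' /m1 /m2 /= /distribution /pushforward.
  have GB : G B by rewrite -(measurable_g_measurableTypeE sG).
  exact: indep.
have mf' : measurable_fun setT (EFin \o f) by exact/measurable_EFinP.
have fi : (m1 \x m2)%E.-integrable setT (EFin \o f).
  apply: measurable_bounded_integrable => //.
    suff : ((m1 \x m2)%E setT < +oo)%E by [].
    by rewrite mE// /m' /= /distribution /pushforward preimage_setT probability_setT ltry.
  exists M; split; first exact: num_real.
  by move=> x Mx w _ /=; rewrite (le_trans (fM w))// ltW.
have mfx x : measurable_fun setT (fun y : n.-tuple R => f (x, y)).
  exact: measurableT_comp mf (measurable_pair1 x).
have mfxv x : measurable_fun setT (fun v => f (x, tuple_of_fun v)).
  exact: measurableT_comp (mfx x) measurable_tuple_of_fun.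
have FE x : fubini_F m2 (EFin \o f) x =
    (\int[P]_v f (x, tuple_of_fun v))%:E.
  rewrite /fubini_F /m2 integral_distribution//.
  - by rewrite -(integral_EFin_Rintegral (mfxv x) (fun v => fM _)).
  - exact/measurable_EFinP.
  - exact: (bounded_integrable (mfxv x) (fun v => fM _)).
have mF := measurable_fubini_F fi.
have mFT : measurable_fun [set: T]
    (fun w => (\int[P]_v f (w, tuple_of_fun v))%:E).
  have := measurableT_comp mF mid.
  by rewrite (_ : _ \o _ = fun w => (\int[P]_v f (w, tuple_of_fun v))%:E)//;
    apply/funext => w; rewrite /= FE.
have mFR : measurable_fun [set: T] (fun w : T => \int[P]_v f (w, tuple_of_fun v)).
  exact/measurable_EFinP.
have FM w : `|\int[P]_v f (w, tuple_of_fun v)| <= M.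
  exact: Rintegral_norm_le (mfxv w) (fun v => fM _).
split=> //; congr fine.
have := integral12_prod_meas1 fi.
rewrite (_ : fubini_F m2 (EFin \o f) =
  fun w => (\int[P]_v f (w, tuple_of_fun v))%:E); last exact/funext.
rewrite /m1 integral_distribution//=; last exact: (bounded_integrable mFR FM).
  move=> ->; rewrite (eq_measure_integral m'); last by move=> A mA _; exact: mE.
  rewrite /m' integral_distribution//.
  apply: (bounded_integrable _ (fun w => fM _)).
  exact: measurableT_comp mf mpr.
by move: mF; rewrite (_ : fubini_F m2 (EFin \o f) =
  fun w => (\int[P]_v f (w, tuple_of_fun v))%:E); last exact/funext.
Qed.

End independence.

End expectation.

Section vector_facts.
Context {R : realType}.

Lemma dotE n (u v : 'cV[R]_n) : dot u v = \sum_j u j ord0 * v j ord0.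
Proof. by rewrite /dot mxE; apply: eq_bigr => j _; rewrite mxE. Qed.

Lemma cexp_i (r : R) : cexp ('i * r%:C) = (cos r +i* sin r).
Proof.
rewrite /cexp /= !mul0r !mul1r subr0 add0r expR0.
exact: mul1r.
Qed.

Lemma continuous_dotl n (v : 'cV[R]_n) : continuous (fun u : 'cV[R]_n => dot u v).
Proof.
move=> u; rewrite (_ : (fun u => dot u v) = (fun u => \sum_j u j ord0 * v j ord0)).
  by apply: (@cvg_sumr _ _ _ (nbhs u)) => j; apply: cvgM;
    [exact: coord_continuous|exact: cvg_cst].
by apply/funext => w; rewrite dotE.
Qed.

End vector_facts.

(** * Levy processes frozen along a grid *)

Section levy.
Context {R : realType} {dO : measure_display} {Omega : measurableType dO}.
Variables (P : probability Omega R) (F : R -> set_system Omega) (n : nat).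
Variables (Z : R -> Omega -> 'cV[R]_n) (psi : 'cV[R]_n -> R[i]).
Hypotheses (hF : filtration F) (hZ : levy_process P F Z).
Hypothesis hpsi : characteristic_exponent P Z psi.

Lemma levy_right_continuous w (t : R) : 0 <= t -> Z s w @[s --> t^'+] --> Z t w.
Proof. by move=> t0; case: hZ => -[cZ _] _ _ _; exact: (cZ w).1. Qed.

Lemma levy_gmeasurable (t : R) j : 0 <= t ->
  gmeasurable_fun (F t) (fun w => Z t w j ord0).
Proof.
move=> t0; case: hZ => -[_ aZ] _ _ _.
apply: (measurable_wrt_comp (g := fun u : 'cV[R]_n => u j ord0)).
- exact: (filtration_sigma hF).
- exact: aZ.
- exact: coord_continuous.
Qed.

Lemma levy_measurable (t : R) j : 0 <= t ->
  measurable_fun setT (fun w => Z t w j ord0).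
Proof.
by move=> t0; apply: (gmeasurable_fun_measurable hF t0); exact: levy_gmeasurable.
Qed.

Lemma measurable_dot (U : Omega -> 'cV[R]_n) eta :
  (forall j, measurable_fun setT (fun w => U w j ord0)) ->
  measurable_fun setT (fun w => dot (U w) eta).
Proof.
move=> mU; rewrite (_ : (fun w => _) = (fun w => \sum_j U w j ord0 * eta j ord0)).
  by apply: measurable_sum => j; exact: measurable_funM.
by apply/funext => w; rewrite dotE.
Qed.

(** Real part of the identity that defines [psi]; [levy_sin] is the imaginary part. The estimates
    are carried out with these real integrals. *)
Lemma levy_cos (t : R) eta : 0 <= t ->
  \int[P]_w cos (dot (Z t w) eta) =
  expR (- (t * complex.Re (psi eta))) * cos (t * complex.Im (psi eta)).
Proof.
move=> /hpsi - /(_ eta); under eq_fun do rewrite cexp_i.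
move=> /(congr1 (@complex.Re R)) /= ->; case: (psi eta) => a b /=.
by rewrite !mul0r !subr0 addr0 cosN.
Qed.

Lemma levy_sin (t : R) eta : 0 <= t ->
  \int[P]_w sin (dot (Z t w) eta) =
  - (expR (- (t * complex.Re (psi eta))) * sin (t * complex.Im (psi eta))).
Proof.
move=> /hpsi - /(_ eta); under eq_fun do rewrite cexp_i.
move=> /(congr1 (@complex.Im R)) /= ->; case: (psi eta) => a b /=.
by rewrite !mul0r subr0 !addr0 sinN mulrN.
Qed.

Lemma levy_increment_law (g : R -> R) (M s h : R) eta : 0 <= s -> 0 <= h ->
  measurable_fun setT g -> (forall x, `|g x| <= M) ->
  \int[P]_w g (dot (Z (s + h) w - Z s w) eta) = \int[P]_w g (dot (Z h w) eta).
Proof.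
move=> s0 h0 mg gM; have sh0 : 0 <= s + h by exact: addr_ge0.
have mU (u v : R) : 0 <= u -> 0 <= v ->
    measurable_fun setT (fun w => dot (Z u w - Z v w) eta).
  move=> u0 v0; apply: measurable_dot => j.
  under eq_fun do rewrite !mxE.
  by apply: measurable_funB; exact: levy_measurable.
have mgf f : measurable_fun [set: Omega] f -> measurable_fun setT (g \o f).
  by move=> mf; exact: measurableT_comp.
(* Stationarity compares with [Z h - Z 0], and [Z 0] vanishes only almost surely. *)
transitivity (\int[P]_w g (dot (Z h w - Z 0 w) eta)); last first.
  apply: ae_eq_Rintegral; [exact/mgf/mU| |].
    by apply: mgf; apply: measurable_dot => j; exact: levy_measurable.
  by case: hZ => _ + _ _; apply: filterS => w ->; rewrite subr0.
have pE : (\int[distribution P (mfun_Sub (mem_set (mU _ _ sh0 s0)))]_x (g x)%:E =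
    \int[distribution P (mfun_Sub (mem_set (mU _ _ h0 (lexx 0))))]_x (g x)%:E)%E.
  apply: eq_measure_integral => A mA _.
  case: hZ => _ _ _ /(_ s h s0 h0 [set v | A (dot v eta)]); apply.
  apply: (borel_preimage (g := fun v => dot v eta)); first exact: continuous_dotl.
  by rewrite borelE.
have mgE : measurable_fun setT (EFin \o g) by exact/measurable_EFinP.
congr fine; move: pE; rewrite !integral_distribution//.
- by apply: (@bounded_integrable _ _ _ P _ M) => //; exact/mgf/mU.
- by apply: (@bounded_integrable _ _ _ P _ M) => //; exact/mgf/mU.
Qed.

Lemma levy_increment_tuple_indep (s h : R) A (B : set (n.-tuple R)) :
  0 <= s -> 0 <= h -> F s A -> measurable B ->
  let V := tuple_of_fun (fun l w => Z (s + h) w l ord0 - Z s w l ord0) in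
  P (A `&` V @^-1` B) = (P A * P (V @^-1` B))%E.
Proof.
move=> s0 h0 FA mB V.
pose phi (v : borel_space n) : n.-tuple R := [tuple v l ord0 | l < n].
have mphi : measurable_fun setT phi.
  apply/measurable_fun_tnthP => l _ C mC; rewrite setTI.
  rewrite (_ : _ @^-1` C = (fun v : 'cV[R]_n => v l ord0) @^-1` C).
    by apply: borel_preimage; [exact: coord_continuous|rewrite borelE].
  by apply/seteqP; split => v /=; rewrite tnth_mktuple.
have VE : V @^-1` B = [set w | (phi @^-1` B) (Z (s + h) w - Z s w)].
  suff E w : V w = phi (Z (s + h) w - Z s w) by apply/seteqP; split => w /=; rewrite E.
  by apply: eq_mktuple => l; rewrite !mxE.
rewrite VE; case: hZ => _ _ + _; apply => //; first by rewrite lerDl.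
by rewrite -[X in borel X]setTI; exact: mphi.
Qed.

(** Real form of [E exp(i (Y + eta . D)) = E (exp(i Y) exp(- h psi(eta)))], where [D] is the
    increment over [[s, s + h]] while [Y] and [eta] belong to the past. The addition formula for the
    cosine reduces it to [levy_cos] and [levy_sin]. *)
Lemma levy_freeze (s h : R) (Y : Omega -> R) (eta : Omega -> 'cV[R]_n) :
  0 <= s -> 0 <= h -> gmeasurable_fun (F s) Y ->
  (forall l, gmeasurable_fun (F s) (fun w => eta w l ord0)) ->
  let A w := expR (- (h * complex.Re (psi (eta w)))) *
             cos (Y w - h * complex.Im (psi (eta w))) in
  measurable_fun setT A /\
  \int[P]_w cos (Y w + dot (Z (s + h) w - Z s w) (eta w)) = \int[P]_w A w.
Proof.
move=> s0 h0 mY meta A; have sh0 : 0 <= s + h by exact: addr_ge0.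
pose D l w := Z (s + h) w l ord0 - Z s w l ord0.
have mD l : measurable_fun setT (D l).
  by apply: measurable_funB; exact: levy_measurable.
(* The first component holds the past and the second the increment, so [Y] and [eta] are constants
   in the inner integral. *)
pose f (z : g_sigma_algebraType (F s) * n.-tuple R) : R :=
  cos (Y z.1 + \sum_l tnth z.2 l * eta z.1 l ord0).
have mcos : measurable_fun [set: R] (@cos R).
  by apply: continuous_measurable_fun; exact: continuous_cos.
have msin : measurable_fun [set: R] (@sin R).
  by apply: continuous_measurable_fun; exact: continuous_sin.
have mf : measurable_fun setT f.
  apply: measurableT_comp => //; apply: measurable_funD.
    exact: measurableT_comp mY measurable_fst.
  apply: measurable_sum => l; apply: measurable_funM.
    exact: measurableT_comp (measurable_tnth l) measurable_snd.
  exact: measurableT_comp (meta l) measurable_fst.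
have fM z : `|f z| <= 1 by rewrite ler_norml cos_geN1 cos_le1.
have dotD v w : \sum_l tnth (tuple_of_fun D v) l * eta w l ord0 =
    dot (Z (s + h) v - Z s v) (eta w).
  by rewrite dotE; apply: eq_bigr => l _; rewrite tnth_mktuple !mxE.
have [] := independent_fubini (filtration_sigma hF s0) (filtration_measurable hF s0)
  mD (fun A B FA mB => levy_increment_tuple_indep s0 h0 FA mB) mf fM.
have -> : (fun w : Omega => \int[P]_v f (w, tuple_of_fun D v)) = A.
  apply/funext => w; rewrite /f /=.
  under eq_Rintegral do rewrite dotD cosD.
  have mdot : measurable_fun setT (fun v => dot (Z (s + h) v - Z s v) (eta w)).
    apply: measurable_dot => l; rewrite (_ : (fun v => _) = D l)//.
    by apply/funext => v; rewrite !mxE.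
  have icos : P.-integrable setT (EFin \o (fun v => cos (dot (Z (s + h) v - Z s v) (eta w)))).
    apply: (@bounded_integrable _ _ _ P _ 1); first exact: measurableT_comp.
    by move=> v; rewrite ler_norml cos_geN1 cos_le1.
  have isin : P.-integrable setT (EFin \o (fun v => sin (dot (Z (s + h) v - Z s v) (eta w)))).
    apply: (@bounded_integrable _ _ _ P _ 1); first exact: measurableT_comp.
    by move=> v; rewrite ler_norml sin_geN1 sin_le1.
  rewrite RintegralB//; last 2 first.
  - by have := integrableZl measurableT (cos (Y w)) icos; apply: eq_integrable.
  - by have := integrableZl measurableT (sin (Y w)) isin; apply: eq_integrable.
  rewrite !RintegralZl//.
  rewrite (levy_increment_law (g := @cos R) (M := 1))//; last first.
    by move=> v; rewrite ler_norml cos_geN1 cos_le1.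
  rewrite (levy_increment_law (g := @sin R) (M := 1))//; last first.
    by move=> v; rewrite ler_norml sin_geN1 sin_le1.
  by rewrite levy_cos// levy_sin// /A cosB; ring.
move=> mA E; split => //; rewrite -E; apply: eq_Rintegral => w _.
by rewrite /f /= dotD.
Qed.

End levy.

(** * Elementary inequalities *)

Section real_bounds.
Context {R : realType}.
Implicit Types x y p q : R.

Lemma cos_lipschitz p q : `|cos p - cos q| <= `|p - q|.
Proof.
wlog pq : p q / p <= q => [H|].
  by have [/H//|/ltW/H] := leP p q; rewrite distrC (distrC q).
have [|c _ E] := @MVT_segment R (@cos R) (fun x => - sin x) p q pq.
  by apply: continuous_subspaceT; exact: continuous_cos.
rewrite distrC E normrM normrN (distrC p) ler_piMl// sin_max//.
Qed.

Lemma expRN_lipschitz x y : 0 <= x -> 0 <= y ->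
  `|expR (- x) - expR (- y)| <= `|x - y|.
Proof.
wlog xy : x y / x <= y => [H x0 y0|x0 _].
  have [xy|/ltW yx] := leP x y; first exact: H.
  by rewrite distrC (distrC x); exact: H.
rewrite ger0_norm ?subr_ge0 ?ler_expR ?lerN2// distrC ger0_norm ?subr_ge0//.
have -> : expR (- y) = expR (- x) * expR (- (y - x)).
  by rewrite -expRD; congr expR; ring.
rewrite -[X in X - _]mulr1 -mulrBr.
have ex1 : expR (- x) <= 1 by rewrite -expR0 ler_expR oppr_le0.
have u1 : 0 <= 1 - expR (- (y - x)).
  by rewrite subr_ge0 -expR0 ler_expR oppr_le0 subr_ge0.
apply: le_trans (ler_piMl u1 ex1) _.
by rewrite lerBlDr -lerBlDl; exact: expR_ge1Dx.
Qed.

(** Real counterpart of the fact that [exp(- z)] is 1-Lipschitz on the right half plane; this is why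
    the real part of [psi] must be shown nonnegative. *)
Lemma damped_cos_lipschitz x y p q : 0 <= x -> 0 <= y ->
  `|expR (- x) * cos p - expR (- y) * cos q| <= `|x - y| + `|p - q|.
Proof.
move=> x0 y0.
have -> : expR (- x) * cos p - expR (- y) * cos q =
  (expR (- x) - expR (- y)) * cos p + expR (- y) * (cos p - cos q) by ring.
rewrite (le_trans (ler_normD _ _))// lerD// normrM.
  by rewrite (le_trans _ (expRN_lipschitz x0 y0))// ler_piMr// cos_max.
rewrite (le_trans _ (cos_lipschitz p q))// ler_piMl// gtr0_norm ?expR_gt0//.
by rewrite -expR0 ler_expR oppr_le0.
Qed.

Lemma damped_cos_bound x p : 0 <= x -> `|expR (- x) * cos p| <= 1.
Proof.
move=> x0; rewrite normrM -[leRHS]mulr1 ler_pM ?cos_max// gtr0_norm ?expR_gt0//.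
by rewrite -expR0 ler_expR oppr_le0.
Qed.

Lemma cvg_right_seq (V : R -> R) (u : nat -> R) p :
  V v @[v --> p^'+] --> V p -> (forall k, p <= u k) ->
  u k @[k --> \oo] --> p -> V (u k) @[k --> \oo] --> V p.
Proof.
move=> /cvgrPdist_le rV pu /cvgrPdist_lt up; apply/cvgrPdist_le => e e0.
have [d /= d0 Hd] := rV e e0; have := up d d0; apply: filterS => k /= ku.
have := pu k; rewrite le_eqVlt => /predU1P[<-|puk].
  by rewrite subrr normr0 ltW.
exact: Hd.
Qed.

Lemma dot_norm_le n (u v : 'cV[R]_n) (M : R) : (forall l, `|v l ord0| <= M) ->
  `|dot u v| <= \sum_l `|u l ord0| * M.
Proof.
move=> vM; rewrite dotE (le_trans (ler_norm_sum _ _ _))//.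
by apply: ler_sum => l _; rewrite normrM ler_wpM2l.
Qed.

Lemma cvg_entry (T : Type) (G : set_system T) {FG : Filter G} m n
    (f : T -> 'M[R]_(m, n)) (A : 'M[R]_(m, n)) i j :
  f x @[x --> G] --> A -> f x i j @[x --> G] --> A i j.
Proof.
move=> fA; apply: (@cvg_comp _ _ _ f (fun B : 'M[R]_(m, n) => B i j) _ _ _ fA).
exact: coord_continuous.
Qed.

End real_bounds.

(** * Sign, local boundedness and continuity of the characteristic exponent *)

Section levy_regularity.
Context {R : realType} {dO : measure_display} {Omega : measurableType dO}.
Variables (P : probability Omega R) (F : R -> set_system Omega) (n : nat).
Variables (Z : R -> Omega -> 'cV[R]_n) (psi : 'cV[R]_n -> R[i]).
Hypotheses (hF : filtration F) (hZ : levy_process P F Z).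
Hypothesis hpsi : characteristic_exponent P Z psi.

Lemma measurable_cos : measurable_fun [set: R] (@cos R).
Proof. by apply: continuous_measurable_fun; exact: continuous_cos. Qed.

Lemma measurable_sin : measurable_fun [set: R] (@sin R).
Proof. by apply: continuous_measurable_fun; exact: continuous_sin. Qed.

Lemma levy_cosB (t p : R) eta : 0 <= t ->
  \int[P]_w cos (dot (Z t w) eta - p) =
  expR (- (t * complex.Re (psi eta))) * cos (t * complex.Im (psi eta) + p).
Proof.
move=> t0; have mdot : measurable_fun setT (fun w => dot (Z t w) eta).
  by apply: measurable_dot => j; exact: (levy_measurable hF hZ).
have icos : P.-integrable setT (EFin \o (fun w => cos (dot (Z t w) eta))).
  apply: (@bounded_integrable _ _ _ P _ 1); last by move=> w; rewrite cos_max.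
  exact: measurableT_comp measurable_cos mdot.
have isin : P.-integrable setT (EFin \o (fun w => sin (dot (Z t w) eta))).
  apply: (@bounded_integrable _ _ _ P _ 1); last by move=> w; rewrite sin_max.
  exact: measurableT_comp measurable_sin mdot.
under eq_Rintegral do rewrite cosB.
rewrite RintegralD//; last 2 first.
- by have := integrableZr measurableT (cos p) icos; apply: eq_integrable.
- by have := integrableZr measurableT (sin p) isin; apply: eq_integrable.
rewrite !RintegralZr// (levy_cos hpsi)// (levy_sin hpsi)// cosD; ring.
Qed.

(** At time 1 the phase [- Im psi] cancels the oscillation, so [exp(- Re psi)] is the integral of a
    cosine and at most 1. *)
Lemma Re_exponent_ge0 eta : 0 <= complex.Re (psi eta).
Proof.
have := @levy_cosB 1 (- complex.Im (psi eta)) eta ler01.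
rewrite !mul1r subrr cos0 mulr1 => E.
rewrite -oppr_le0 -ler_expR expR0 -E.
rewrite (le_trans (ler_norm _))//; apply: Rintegral_norm_le.
  apply: measurableT_comp measurable_cos _; apply: measurable_funB => //.
  by apply: measurable_dot => j; exact: (levy_measurable hF hZ).
by move=> w; rewrite cos_max.
Qed.

(* Conditioning on the last increment shifts the phase [p]; quantifying over
   [p] is what makes the induction close without complex numbers. *)
Lemma discrete_exponential_approx (t e C : R) (N : nat) (eta0 : 'cV[R]_n)
    (eta : nat -> Omega -> 'cV[R]_n) (B : set Omega) :
  0 <= t -> 0 <= C -> measurable B ->
  (forall k l, gmeasurable_fun (F (grid t N k)) (fun w => eta k w l ord0)) ->
  (forall k w, (k < N.+1)%N ->
    `|complex.Re (psi (eta k w)) - complex.Re (psi eta0)| +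
    `|complex.Im (psi (eta k w)) - complex.Im (psi eta0)| <= e + C * \1_B w) ->
  forall p, `|\int[P]_w cos (\sum_(k < N.+1)
      dot (Z (grid t N k.+1) w - Z (grid t N k) w) (eta k w) - p) -
    expR (- (t * complex.Re (psi eta0))) * cos (t * complex.Im (psi eta0) + p)|
  <= t * (e + C * fine (P B)).
Proof.
move=> t0 C0 mB meta He; set a0 := complex.Re _; set b0 := complex.Im _.
pose g := grid t N; pose h := t / N.+1%:R.
have h0 : 0 <= h by rewrite divr_ge0.
have gS k : g k.+1 = g k + h.
  by rewrite /g /grid -natr1 mulrDr mulr1 mulrDl.
have g0 k : 0 <= g k by exact: grid_ge0.
pose Y m w := \sum_(k < m) dot (Z (g k.+1) w - Z (g k) w) (eta k w).
have mY m : gmeasurable_fun (F (g m)) (Y m).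
  apply: measurable_sum => k.
  rewrite (_ : (fun w => _) = (fun w => \sum_l (Z (g k.+1) w l ord0 -
     Z (g k) w l ord0) * eta k w l ord0)); last first.
    by apply/funext => w; rewrite dotE; apply: eq_bigr => l _; rewrite !mxE.
  have km : (k < m)%N by [].
  apply: measurable_sum => l; apply: measurable_funM.
    by apply: measurable_funB;
      apply: (gmeasurable_fun_le hF) (levy_gmeasurable hF hZ l (g0 _)) => //;
      apply: le_grid => //; exact: ltnW.
  by apply: (gmeasurable_fun_le hF) (meta k l) => //; apply: le_grid => //; exact: ltnW.
have mYT m : measurable_fun setT (Y m) by exact: gmeasurable_fun_measurable (mY m).
suff H m : (m <= N.+1)%N -> forall p, `|\int[P]_w cos (Y m w - p) -
    expR (- (g m * a0)) * cos (g m * b0 + p)| <= g m * (e + C * fine (P B)).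
  by move=> p; have := H N.+1 (leqnn _) p; rewrite /g grid_last.
elim: m => [_ p|m IH mN p].
  rewrite /g grid0 !mul0r oppr0 expR0 mul1r add0r.
  under eq_Rintegral do rewrite /Y big_ord0 sub0r cosN.
  by rewrite Rintegral_const subrr normr0.
have mYp : gmeasurable_fun (F (g m)) (fun w => Y m w - p).
  by apply: measurable_funB; [exact: mY|exact: measurable_cst].
have [mA E] := levy_freeze hF hZ hpsi (g0 m) h0 mYp (meta m).
have -> : \int[P]_w cos (Y m.+1 w - p) =
    \int[P]_w (expR (- (h * complex.Re (psi (eta m w)))) *
             cos (Y m w - p - h * complex.Im (psi (eta m w)))).
  rewrite -E; apply: eq_Rintegral => w _; rewrite /Y big_ord_recr/= gS.
  by congr cos; ring.
have Re0 eta' := Re_exponent_ge0 eta'.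
have a00 : 0 <= a0 by exact: Re0.
(* The random exponent is replaced by the fixed one over a single grid step: the cost is [h e], plus
   [h C] on the bad event. *)
have step : `|\int[P]_w (expR (- (h * complex.Re (psi (eta m w)))) *
             cos (Y m w - p - h * complex.Im (psi (eta m w)))) -
    \int[P]_w (expR (- (h * a0)) * cos (Y m w - p - h * b0))|
  <= h * e + (h * C) * fine (P B).
  apply: (@Rintegral_dist_le _ _ _ P _ _ 1) => //.
  - apply: measurable_funM => //; apply: measurableT_comp measurable_cos _.
    by do 2 apply: measurable_funB => //.
  - by move=> w; apply: damped_cos_bound; exact: mulr_ge0.
  - by move=> w; apply: damped_cos_bound; exact: mulr_ge0.
  - exact: mulr_ge0.
  - move=> w; apply: (le_trans (damped_cos_lipschitz _ _ _ _)); try exact: mulr_ge0.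
    rewrite -mulrBr.
    have -> : Y m w - p - h * complex.Im (psi (eta m w)) - (Y m w - p - h * b0) =
      - (h * (complex.Im (psi (eta m w)) - b0)) by ring.
    rewrite normrN 2!(normrM h) (ger0_norm h0) -mulrDr -mulrA -mulrDr ler_wpM2l//.
    exact: He.
have icos q : P.-integrable setT (EFin \o (fun w => cos (Y m w - q))).
  apply: (@bounded_integrable _ _ _ P _ 1); last by move=> w; rewrite cos_max.
  by apply: measurableT_comp measurable_cos _; exact: measurable_funB.
(* Integrating the last increment has moved the phase by [h * b0]. *)
have {IH} := IH (ltnW mN) (p + h * b0).
have -> : g m.+1 * (e + C * fine (P B)) =
  (h * e + (h * C) * fine (P B)) + g m * (e + C * fine (P B)) by rewrite gS; ring.
move=> IH; apply: (le_trans (ler_distD (\int[P]_w (expR (- (h * a0)) * cos (Y m w - p - h * b0))) _ _)).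
apply: lerD => //.
have -> : expR (- (g m.+1 * a0)) * cos (g m.+1 * b0 + p) =
  expR (- (h * a0)) * (expR (- (g m * a0)) * cos (g m * b0 + (p + h * b0))).
  by rewrite mulrA -expRD gS; congr (expR _ * cos _); ring.
under eq_Rintegral do rewrite -addrA -opprD.
(* The factor [exp(- h a0)] is at most 1, so earlier errors are not amplified and the costs of the
   steps just add up. *)
rewrite RintegralZl// -mulrBr normrM gtr0_norm ?expR_gt0//.
apply: le_trans IH; rewrite ler_piMl//.
by rewrite -expR0 ler_expR oppr_le0 mulr_ge0.
Qed.

Lemma bounded_cvg_Rintegral (f : nat -> Omega -> R) (g : Omega -> R) (M : R) :
  (forall k, measurable_fun setT (f k)) -> measurable_fun setT g ->
  (forall k w, `|f k w| <= M) ->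
  {ae P, forall w, f k w @[k --> \oo] --> g w} ->
  \int[P]_w f k w @[k --> \oo] --> \int[P]_w g w.
Proof.
move=> mf mg fM fg.
have [|||||gi _] := @dominated_convergence _ _ _ P setT measurableT
  (fun k w => (f k w)%:E) (fun w => (g w)%:E) (fun=> M%:E).
- by move=> k; exact/measurable_EFinP.
- exact/measurable_EFinP.
- by move: fg; apply: filterS => w fw _; apply: cvg_EFin; [exact: nearW|exact: fw].
- by apply: (@bounded_integrable _ _ _ P (fun=> M) `|M|).
- by apply/aeW => w k _; rewrite /= lee_fin.
move=> H; apply: fine_cvg; rewrite fineK//; exact: integrable_fin_num.
Qed.

(** A failing sequence has times tending to 0 and bounded frequencies. Right continuity at 0 sends
    the phases to 0, and dominated convergence makes the integrals tend to 1. *)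
Lemma levy_cos_near0 (M : R) : exists2 t0 : R, 0 < t0 &
  forall (s : R) (eta : 'cV[R]_n), 0 <= s -> s <= t0 -> (forall l, `|eta l ord0| <= M) ->
    2^-1 <= \int[P]_w cos (dot (Z s w) eta).
Proof.
apply: contrapT => /forall2NP H.
have /choice[u Hu] : forall k, exists z : R * 'cV[R]_n,
    [/\ 0 <= z.1, z.1 <= k.+1%:R^-1, forall l, `|z.2 l ord0| <= M &
       \int[P]_w cos (dot (Z z.1 w) z.2) < 2^-1].
  move=> k; have [|] := H k.+1%:R^-1; first by rewrite invr_gt0 ltr0n.
  move=> /existsNP[s] /existsNP[eta] /not_implyP[s0] /not_implyP[sk].
  by move=> /not_implyP[eM] /negP; rewrite -ltNge => ?; exists (s, eta).
have mdot k : measurable_fun setT (fun w => dot (Z (u k).1 w) (u k).2).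
  apply: measurable_dot => j; apply: (levy_measurable hF hZ).
  by have [] := Hu k.
have : \int[P]_w cos (dot (Z (u k).1 w) (u k).2) @[k --> \oo] -->
    \int[P]_(w in [set: Omega]) (1 : R).
  apply: (@bounded_cvg_Rintegral _ _ 1) => //.
  - by move=> k; exact: measurableT_comp measurable_cos (mdot k).
  - by move=> k w; rewrite cos_max.
  case: hZ => _ + _ _; apply: filterS => w Z0.
  rewrite -[X in _ --> X]cos0.
  apply: (@cvg_comp _ _ _ _ (@cos R)); last exact: continuous_cos.
  have Zl l : Z (u k).1 w l ord0 @[k --> \oo] --> (0 : R).
    rewrite -[X in _ --> X](_ : Z 0 w l ord0 = 0); last by rewrite Z0 mxE.
    apply: (@cvg_right_seq R (fun s => Z s w l ord0) (fun k => (u k).1)).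
    - exact: (cvg_entry (levy_right_continuous hZ (lexx 0))).
    - by move=> k; have [] := Hu k.
    - apply: (@squeeze_cvgr _ _ _ _ (cst 0) (fun k => k.+1%:R^-1)).
      + by apply: nearW => k; have [-> ->] := Hu k.
      + exact: cvg_cst.
      + exact: cvg_harmonic.
  have sum0 : \sum_l `|Z (u k).1 w l ord0| * M @[k --> \oo] --> (0 : R).
    have s0 : \sum_(l < n) `|0 : R| * M = 0.
      by rewrite big1// => l _; rewrite normr0 mul0r.
    rewrite -[X in _ --> X]s0.
    apply: cvg_sumr => l; apply: cvgM; last exact: cvg_cst.
    exact: cvg_norm.
  apply: (@squeeze_cvgr _ _ _ _ (fun k => - \sum_l `|Z (u k).1 w l ord0| * M)
    (fun k => \sum_l `|Z (u k).1 w l ord0| * M)) => //.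
    apply: nearW => k; rewrite -ler_norml; apply: dot_norm_le.
    by have [] := Hu k.
  by rewrite -[X in _ --> X]oppr0; exact: cvgN.
rewrite Rintegral_const => /cvgr_gt/(_ 2^-1); rewrite invf_lt1 ?ltr1n//.
move=> /(_ isT)[k _ /(_ k (leqnn k))] /=.
by have [_ _ _ /lt_trans H'] := Hu k; move=> /H'; rewrite ltxx.
Qed.

(** [exp(- s Re psi) cos(s Im psi)] is at least 1/2 for every [s] in [[0, t0]], so the phase
    [s Im psi], which starts at 0, cannot reach [pi / 2] in absolute value. This selects the branch
    of the logarithm. *)
Lemma exponent_strip (M : R) : exists2 t0 : R, 0 < t0 &
  forall eta : 'cV[R]_n, (forall l, `|eta l ord0| <= M) ->
    2^-1 <= expR (- (t0 * complex.Re (psi eta))) /\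
    - (pi / 2) < t0 * complex.Im (psi eta) < pi / 2.
Proof.
have [t0 t00 H] := levy_cos_near0 M; exists t0 => // eta eM.
have He s : 0 <= s -> s <= t0 ->
    2^-1 <= expR (- (s * complex.Re (psi eta))) * cos (s * complex.Im (psi eta)).
  by move=> s0 st; rewrite -(levy_cos hpsi)//; exact: H.
split.
  rewrite (le_trans (He _ (ltW t00) (lexx _)))// ler_piMr ?expR_ge0 ?cos_le1//.
rewrite -ltr_norml ltNge; apply/negP => Hp.
set b := complex.Im (psi eta) in He Hp *.
have b0 : 0 < `|b|.
  rewrite normr_gt0; apply/negP => /eqP b0; move: Hp.
  by rewrite b0 mulr0 normr0 leNgt divr_gt0// pi_gt0.
have s0 : 0 <= pi / 2 / `|b| by rewrite !divr_ge0// pi_ge0.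
(* The time at which the phase would reach [pi / 2] in absolute value; there the cosine vanishes and
   contradicts the lower bound. *)
have := He (pi / 2 / `|b|) s0.
rewrite ler_pdivrMr// -(gtr0_norm t00) -normrM => /(_ Hp).
have -> : cos (pi / 2 / `|b| * b) = 0.
  rewrite -cos_norm normrM (ger0_norm s0) divfK ?gt_eqF//.
  exact: cos_pihalf.
by rewrite mulr0 leNgt invr_gt0 ltr0n.
Qed.

Lemma exponent_bounded (M : R) : exists C : R,
  forall eta : 'cV[R]_n, (forall l, `|eta l ord0| <= M) ->
    `|complex.Re (psi eta)| + `|complex.Im (psi eta)| <= C.
Proof.
have [t0 t00 H] := exponent_strip M.
exists ((ln 2 + pi / 2) / t0) => eta /H[H1 H2].
rewrite ler_pdivlMr// mulrDl -{1 2}(gtr0_norm t00) -!normrM lerD//; last first.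
  by rewrite mulrC ltW// ltr_norml.
have p0 : 0 <= t0 * complex.Re (psi eta).
  by apply: mulr_ge0 (ltW t00) _; exact: Re_exponent_ge0.
rewrite mulrC ger0_norm// -ler_expR lnK ?posrE ?ltr0n//.
by move: H1; rewrite expRN lef_pV2// posrE ?ltr0n ?expR_gt0.
Qed.

(** The characteristic function at the time [t0] of the strip is continuous by dominated
    convergence, and inside the strip [psi] is recovered from it by the continuous functions [ln]
    and [atan]. *)
Lemma exponent_continuous (eta0 : 'cV[R]_n) (e : R) : 0 < e -> exists2 dl : R, 0 < dl &
  forall eta : 'cV[R]_n, (forall l, `|eta l ord0 - eta0 l ord0| <= dl) ->
    `|complex.Re (psi eta) - complex.Re (psi eta0)| +
    `|complex.Im (psi eta) - complex.Im (psi eta0)| <= e.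
Proof.
move=> e0; apply: contrapT => /forall2NP H.
have /choice[u Hu] : forall k, exists eta : 'cV[R]_n,
    (forall l, `|eta l ord0 - eta0 l ord0| <= k.+1%:R^-1) /\
    e < `|complex.Re (psi eta) - complex.Re (psi eta0)| +
        `|complex.Im (psi eta) - complex.Im (psi eta0)|.
  move=> k; have [|] := H k.+1%:R^-1; first by rewrite invr_gt0 ltr0n.
  by move=> /existsNP[eta] /not_implyP[eM] /negP; rewrite -ltNge => ?; exists eta.
(* A common bound for [eta0] and the whole sequence, whose entries differ from those of [eta0] by at
   most 1; hence one [t0] serves them all. *)
pose M := \sum_l `|eta0 l ord0| + 1.
have M0 l : `|eta0 l ord0| + 1 <= M.
  by rewrite lerD2r (bigD1 l)//= lerDl sumr_ge0.
have [t0 t00 strip] := exponent_strip M.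
have uM k l : `|u k l ord0| <= M.
  rewrite (le_trans _ (M0 l))// -[X in `|X|](subrK (eta0 l ord0)).
  rewrite (le_trans (ler_normD _ _))// addrC lerD2l.
  by rewrite (le_trans ((Hu k).1 l))// invf_le1 ?ltr0n// ler1n.
have eM l : `|eta0 l ord0| <= M by rewrite (le_trans _ (M0 l))// lerDl.
have mdot eta : measurable_fun setT (fun w => dot (Z t0 w) eta).
  by apply: measurable_dot => j; apply: (levy_measurable hF hZ); exact: ltW.
have dotc w : dot (Z t0 w) (u k) @[k --> \oo] --> dot (Z t0 w) eta0.
  rewrite dotE; under eq_fun do rewrite dotE.
  apply: cvg_sumr => l; apply: cvgM; first exact: cvg_cst.
  apply/cvgrPdist_le => d d0; near=> k; rewrite distrC.
  rewrite (le_trans ((Hu k).1 l))//; apply: ltW; near: k.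
  exact: (near_infty_natSinv_lt (PosNum d0)).
have cosc : \int[P]_w cos (dot (Z t0 w) (u k)) @[k --> \oo] -->
    \int[P]_w cos (dot (Z t0 w) eta0).
  apply: (@bounded_cvg_Rintegral _ _ 1) => //.
  - by move=> k; exact: measurableT_comp measurable_cos (mdot _).
  - exact: measurableT_comp measurable_cos (mdot _).
  - by move=> k w; rewrite cos_max.
  - apply/aeW => w; apply: (@cvg_comp _ _ _ _ (@cos R)); first exact: dotc.
    exact: continuous_cos.
have sinc : \int[P]_w sin (dot (Z t0 w) (u k)) @[k --> \oo] -->
    \int[P]_w sin (dot (Z t0 w) eta0).
  apply: (@bounded_cvg_Rintegral _ _ 1) => //.
  - by move=> k; exact: measurableT_comp measurable_sin (mdot _).
  - exact: measurableT_comp measurable_sin (mdot _).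
  - by move=> k w; rewrite sin_max.
  - apply/aeW => w; apply: (@cvg_comp _ _ _ _ (@sin R)); first exact: dotc.
    exact: continuous_sin.
pose fc (eta : 'cV[R]_n) := \int[P]_w cos (dot (Z t0 w) eta).
pose fs (eta : 'cV[R]_n) := \int[P]_w sin (dot (Z t0 w) eta).
(* The squared modulus of the characteristic function is [exp(- 2 t0 Re psi)]. *)
have ReE eta : complex.Re (psi eta) = - ln (fc eta ^+ 2 + fs eta ^+ 2) / (2 * t0).
  rewrite /fc /fs (levy_cos hpsi) ?ltW// (levy_sin hpsi) ?ltW//.
  rewrite sqrrN !exprMn -mulrDr cos2Dsin2 mulr1 -expRM_natl expRK.
  by field; rewrite gt_eqF.
(* The quotient is [- tan(t0 Im psi)], and [atan] inverts [tan] because the strip confines the phase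
   to [(- pi / 2, pi / 2)]. *)
have ImE (eta : 'cV[R]_n) : (forall l, `|eta l ord0| <= M) ->
    complex.Im (psi eta) = - atan (fs eta / fc eta) / t0 /\ 0 < fc eta.
  move=> /strip[_ Hb]; rewrite /fc /fs (levy_cos hpsi) ?ltW// (levy_sin hpsi) ?ltW//.
  have c0 := cos_gt0_pihalf Hb; split; last by rewrite mulr_gt0// expR_gt0.
  set E := expR _; set x := t0 * _ in Hb c0 *.
  have -> : - (E * sin x) / (E * cos x) = - tan x.
    by rewrite /tan; field; rewrite !gt_eqF// expR_gt0.
  by rewrite atanN opprK tanK ?in_itv//= /x; field; rewrite gt_eqF.
have fc0 : 0 < fc eta0 by have [] := ImE eta0 eM.
have Rec : complex.Re (psi (u k)) @[k --> \oo] --> complex.Re (psi eta0).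
  rewrite ReE; under eq_fun do rewrite ReE.
  apply: cvgM; last exact: cvg_cst; apply: cvgN.
  apply: (@cvg_comp _ _ _ _ (@ln R)); last first.
    by apply: continuous_ln; rewrite ltr_pwDl ?exprn_gt0// sqr_ge0.
  by apply: cvgD; rewrite !expr2; under eq_fun do rewrite expr2; exact: cvgM.
have Imc : complex.Im (psi (u k)) @[k --> \oo] --> complex.Im (psi eta0).
  rewrite (ImE _ eM).1; under eq_fun do rewrite (ImE _ (uM _)).1.
  apply: cvgM; last exact: cvg_cst; apply: cvgN.
  apply: (@cvg_comp _ _ _ _ (@atan R)); last exact: continuous_atan.
  by apply: cvgM => //; apply: cvgV => //; rewrite gt_eqF.
have : `|complex.Re (psi (u k)) - complex.Re (psi eta0)| +
  `|complex.Im (psi (u k)) - complex.Im (psi eta0)| @[k --> \oo] --> (0 : R).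
  rewrite -[X in _ --> X](addr0 0) -{1}(@normr0 _ R) -{2}(@normr0 _ R).
  rewrite -{1}(subrr (complex.Re (psi eta0))) -{1}(subrr (complex.Im (psi eta0))).
  by apply: cvgD; apply: cvg_norm; apply: cvgB => //; exact: cvg_cst.
move=> /cvgr_lt/(_ _ e0)[k _ /(_ k (leqnn k))] /=.
by rewrite ltNge ltW//; exact: (Hu k).2.
Unshelve. all: by end_near. Qed.

End levy_regularity.

(** * The enlarged probability space *)

Section frobenius_facts.
Context {R : realType}.

Lemma continuous_frobenius m n : continuous (@frobenius R m n).
Proof.
move=> A; rewrite /frobenius; apply: (@cvg_comp _ _ _
    (fun B : 'M[R]_(m, n) => \sum_i \sum_j B i j ^+ 2) (@Num.sqrt R)); last first.
  exact: sqrt_continuous.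
apply: (@cvg_sumr _ _ _ (nbhs A)) => i; apply: (@cvg_sumr _ _ _ (nbhs A)) => j.
by rewrite expr2; under eq_fun do rewrite expr2; apply: cvgM; exact: coord_continuous.
Qed.

Lemma entry_le_frobenius m n (A : 'M[R]_(m, n)) i j : `|A i j| <= frobenius A.
Proof.
rewrite -sqrtr_sqr ler_wsqrtr// (bigD1 i)//= (bigD1 j)//= -addrA lerDl.
by rewrite addr_ge0// sumr_ge0// => k _; rewrite ?sqr_ge0// sumr_ge0// => l _; rewrite sqr_ge0.
Qed.

Lemma frobenius0 m n : frobenius (0 : 'M[R]_(m, n)) = 0.
Proof.
rewrite /frobenius big1 ?sqrtr0// => i _; rewrite big1// => j _.
by rewrite mxE expr0n.
Qed.

Lemma continuous_locally_lipschitz d m n (f : 'cV[R]_d -> 'M[R]_(m, n)) i j :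
  locally_lipschitz f -> continuous (fun y => f y i j).
Proof.
move=> lf x; have [U Ux lU] := lf x.
(* The Lipschitz property holds for all constants beyond some [M0]; this choice lies beyond it and
   is positive. *)
have [M0 [_ HM]] := lU; pose M := Num.max M0 0 + 1.
have M0M : M0 < M by rewrite /M ltr_pwDr// le_max lexx.
have Mgt0 : 0 < M by rewrite /M ltr_pwDr// le_max lexx orbT.
have Ux' : U x by exact: nbhs_singleton.
apply: (@cvg_entry _ _ (nbhs x) _ _ _ f (f x)).
apply/cvgrPdist_lt => e e0; near=> y.
have Uy : U y by near: y.
apply: (@le_lt_trans _ _ (M * `|x - y|)); first exact: (HM M M0M (x, y)).
rewrite mulrC -ltr_pdivlMr//; near: y.
by apply: (@cvgr_dist_lt _ _ _ (nbhs x) _ id x) => //; rewrite divr_gt0.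
Unshelve. all: by end_near. Qed.

End frobenius_facts.

Section product_space.
Context {R : realType} {dO : measure_display} {Omega : measurableType dO}.
Variables (P : probability Omega R) (F : R -> set_system Omega) (d : nat).
Hypothesis hF : filtration F.

Local Notation Obar := (@Obar R dO Omega d).
Local Notation Fbar := (@Fbar R dO Omega F d).

Let rect u : set_system Obar := [set B `*` C | B in @borel 'cV[R]_d & C in F u].

(** Right continuity is built into [Fbar]: between [t] and [u] lies the midpoint, at which the
    hypothesis is applied. *)
Lemma Fbar_filtration : filtration Fbar.
Proof.
split.
- move=> t t0; split.
  + by move=> u tu; exact: sigma_algebra0.
  + by move=> A FA u tu; apply: sigma_algebraCD; exact: FA.
  + by move=> A FA u tu; apply: sigma_algebra_bigcup => k; exact: FA.
- move=> t t0 A /(_ (t + 1)); rewrite /= ltrDl ltr01 => /(_ isT).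
  apply: smallest_sub; first exact: sigma_algebra_measurable.
  move=> _ [B bB [C FC <-]]; apply: measurableX => //.
  by apply: (filtration_measurable hF) FC; rewrite addr_ge0.
- by move=> s t s0 st A FA u tu; apply: FA; exact: le_lt_trans tu.
- move=> t t0 A FA u tu; have tu' : t < (t + u) / 2 by rewrite midf_lt.
  by apply: (FA _ tu'); rewrite /= midf_lt.
Qed.

Lemma Fbar_section (x : 'cV[R]_d) t A : 0 <= t -> Fbar t A ->
  F t [set w | A (x, w)].
Proof.
move=> t0 FA; apply: (filtration_right hF) => // u tu.
have u0 : 0 <= u by rewrite (le_trans t0)// ltW.
have sF := filtration_sigma hF u0.
suff H : <<s rect u >> `<=` image_set_system setT (fun w : Omega => (x, w) : Obar) (F u).
  by have := H _ (FA u tu); rewrite /image_set_system /= setTI.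
apply: smallest_sub; first exact: sigma_algebra_image.
move=> _ [B bB [C FC <-]]; rewrite /image_set_system /= setTI.
have [Bx|nBx] := pselect (B x).
  by rewrite (_ : _ @^-1` _ = C)//; apply/seteqP; split => w //= [].
rewrite (_ : _ @^-1` _ = set0); first by case: sF.
by apply/seteqP; split => w //= [].
Qed.

Lemma gmeasurable_section (x : 'cV[R]_d) t (f : Obar -> R) : 0 <= t ->
  gmeasurable_fun (Fbar t) f -> gmeasurable_fun (F t) (fun w => f (x, w)).
Proof.
move=> t0 mf; apply/gmeasurable_funP; first exact: (filtration_sigma hF).
move=> B mB; apply: (Fbar_section x (A := f @^-1` B)) => //.
by apply: (gmeasurable_funP _ (filtration_sigma Fbar_filtration t0)).1.
Qed.

Lemma measurable_section (x : 'cV[R]_d) (A : set Obar) : measurable A ->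
  measurable [set w | A (x, w)].
Proof.
move=> mA; have := measurable_xsection (x : borel_space d) mA.
by rewrite xsectionE.
Qed.

(** The Dirac factor picks out the section at [x]; through this, statements under [Pbar x] become
    statements under [P]. *)
Lemma PbarE (x : 'cV[R]_d) (A : set Obar) : measurable A ->
  Pbar P x A = P [set w | A (x, w)].
Proof.
move=> mA; rewrite /Pbar /= /product_measure1 integral_dirac//.
  by rewrite diracT mul1e /= xsectionE.
exact: measurable_fun_xsection.
Qed.

Lemma ae_section (x : 'cV[R]_d) (Q : Obar -> Prop) : {ae Pbar P x, forall w, Q w} ->
  {ae P, forall w, Q (x, w)}.
Proof.
move=> [A [mA A0 QA]]; exists [set w | A (x, w)]; split.
- exact: measurable_section.
- by rewrite -PbarE.
- by move=> w /= nQ; exact: (QA (x, w)).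
Qed.

Lemma Rintegral_section (x : 'cV[R]_d) (f : Obar -> R) (M : R) :
  measurable_fun setT f -> (forall w, `|f w| <= M) ->
  \int[Pbar P x]_w f w = \int[P]_w f (x, w).
Proof.
move=> mf fM.
have mx : measurable_fun setT (fun w : Omega => (x, w) : Obar).
  move=> _ A mA; rewrite setTI; exact: measurable_section.
congr fine.
rewrite (eq_measure_integral (distribution P (mfun_Sub (mem_set mx)))); last first.
  by move=> A mA _; rewrite PbarE.
rewrite integral_distribution//; first exact/measurable_EFinP.
apply: (@bounded_integrable _ _ _ P _ M) => //.
exact: measurableT_comp mf mx.
Qed.

End product_space.

(** * Integrals of simple processes along grids *)

Section interval_sums.
Context {R : realType}.
Variables (T v : nat -> R) (g : R).
Hypothesis ndT : {homo T : i j / (i <= j)%N >-> i <= j}.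

Lemma sum_interval n i : (i < n)%N -> T i <= g < T i.+1 ->
  \sum_(k < n) v k * (T k <= g < T k.+1)%R%:R = v i.
Proof.
move=> iN /andP[Tig gTi]; rewrite (bigD1 (Ordinal iN))//= Tig gTi mulr1.
rewrite big1 ?addr0// => -[j jN]/= ji.
have [ij|] := ltnP i j.
  rewrite [T j <= g](_ : _ = false) ?mulr0//; apply/negbTE.
  by rewrite -ltNge (lt_le_trans gTi)//; exact: ndT.
rewrite leq_eqVlt -(inj_eq val_inj)/= in ji *; rewrite (negbTE ji)/= => ji'.
rewrite [g < _](_ : _ = false) ?andbF ?mulr0//; apply/negbTE.
by rewrite -leNgt (le_trans _ Tig)//; exact: ndT.
Qed.

Lemma sum_interval_cases n :
  \sum_(k < n) v k * (T k <= g < T k.+1)%R%:R = 0 \/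
  exists i, [/\ (i < n)%N, T i <= g &
    \sum_(k < n) v k * (T k <= g < T k.+1)%R%:R = v i].
Proof.
have [[i iP]|H] := pselect (exists i : 'I_n, T i <= g < T i.+1).
  right; exists i; split=> //; first by case/andP: iP.
  exact: sum_interval.
left; rewrite big1// => i _.
case iP : (_ && _); last by rewrite mulr0.
by case: H; exists i.
Qed.

Lemma interval_exists n : T 0%N <= g -> g < T n ->
  exists2 i, (i < n)%N & T i <= g < T i.+1.
Proof.
move=> T0 gTn; have exi : exists i, g < T i by exists n.
have [[|i] gi mini] := ex_minnP exi; first by move: gi; rewrite ltNge T0.
exists i; first exact: mini.
by rewrite gi andbT leNgt; apply/negP => /mini; rewrite ltnn.
Qed.

End interval_sums.

Section simple_integrals.
Context {R : realType} {dT : measure_display} {T : measurableType dT}.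

Lemma stopped_measurable (c : R) (V : R -> T -> R) (tau : T -> R) :
  (forall w s, 0 <= s -> V v w @[v --> s^'+] --> V s w) ->
  (forall s, 0 <= s -> measurable_fun setT (V s)) ->
  (forall w, 0 <= tau w <= c) ->
  (forall s, 0 <= s -> measurable [set w | tau w <= s]) ->
  measurable_fun setT (fun w => V (tau w) w).
Proof.
move=> rV mV tauc mtau.
have tau0 w : 0 <= tau w by case/andP: (tauc w).
(* The type is inhabited, so the bounds on [tau] at one point yield the sign of [c]. *)
have c0 : 0 <= c by have /andP[+ +] := tauc point; exact: le_trans.
have hT := @filtration_cst R _ T.
have mV' s : 0 <= s -> gmeasurable_fun (@measurable _ T) (V s).
  move=> s0; apply/gmeasurable_funP; first exact: sigma_algebra_measurable.
  by move=> B mB; rewrite -[X in measurable X]setTI; exact: mV.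
have := gmeasurable_fun_measurable hT c0
  (@stopped_gmeasurable _ _ _ _ hT c V tau rV mV' (conj tau0 mtau) c0).
congr measurable_fun; apply/funext => w; rewrite min_l//.
by case/andP: (tauc w).
Qed.

Variables (F : R -> set_system T).
Hypothesis hF : filtration F.
Variables (K : @simple_process R T) (Z : R -> T -> R).
Hypothesis hK : simple_predictable F K.
Hypothesis rZ : forall w s, 0 <= s -> Z v w @[v --> s^'+] --> Z s w.
Hypothesis mZ : forall s, 0 <= s -> gmeasurable_fun (F s) (Z s).

Lemma sp_time_stopping i : (i <= sp_size K)%N -> stopping_time F (sp_time K i).
Proof. by case: hK => _ _ + _ _; exact. Qed.

(** The definition of the stopped sigma-algebra gives the preimages on the event where the interval
    has started by time [g]; elsewhere the product is 0. *)
Lemma sp_val_gmeasurable i g : (i < sp_size K)%N -> 0 <= g ->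
  gmeasurable_fun (F g) (fun w => sp_val K i w * (sp_time K i w <= g)%R%:R).
Proof.
move=> iK g0; have sF := filtration_sigma hF g0.
have stop := sp_time_stopping (ltnW iK).
apply/gmeasurable_funP => // B mB.
have FvB : F g (sp_val K i @^-1` B `&` [set w | sp_time K i w <= g]).
  case: hK => _ _ _ _ /(_ i iK B); rewrite borelE => /(_ mB g g0).
  exact.
have Ft : F g [set w | sp_time K i w <= g] by exact: stop.2.
rewrite (_ : _ @^-1` B = (sp_val K i @^-1` B `&` [set w | sp_time K i w <= g])
  `|` ((fun=> 0) @^-1` B `\` [set w | sp_time K i w <= g])).
  rewrite -(filtration_measurableE hF g0) in FvB Ft *.
  apply: measurableU => //; apply: measurableD => //.
  rewrite preimage_cst; case: ifP => _; [exact: measurableT|exact: measurable0].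
apply/seteqP; split => w /=.
  by case: leP => Tg; rewrite ?mulr1 ?mulr0; [left|right].
move=> [[Bv ->]|[B0 /negP/negbTE ->]]; first by rewrite mulr1.
by rewrite mulr0.
Qed.

(** The starting time is finite, so the indicators that it is at most [N] are eventually 1. *)
Lemma sp_val_measurable i : (i < sp_size K)%N -> measurable_fun setT (sp_val K i).
Proof.
move=> iK; apply: (@measurable_fun_cvg _ _ _ _
  (fun N w => sp_val K i w * (sp_time K i w <= N%:R)%R%:R)).
  move=> N; apply: (gmeasurable_fun_measurable hF (ler0n _ N)).
  exact: sp_val_gmeasurable.
move=> w _; apply: (@cvg_near_cst nat R); near=> N.
rewrite (_ : sp_time K i w <= N%:R) ?mulr1//.
by near: N; exact: nbhs_infty_ger.
Unshelve. all: by end_near. Qed.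

Lemma sp_integral_measurable s : 0 <= s -> measurable_fun setT (sp_integral K Z s).
Proof.
move=> s0; apply: measurable_sum => i; apply: measurable_funM.
  exact: sp_val_measurable.
have mZT j : (j <= sp_size K)%N ->
    measurable_fun setT (fun w => Z (Num.min s (sp_time K j w)) w).
  move=> jK; under eq_fun do rewrite minC.
  apply: (gmeasurable_fun_measurable hF s0).
  exact: (stopped_gmeasurable hF rZ mZ (sp_time_stopping jK) s0).
by apply: measurable_funB; apply: mZT => //; exact: ltnW.
Qed.

Lemma sp_integral_right w s : 0 <= s ->
  sp_integral K Z v w @[v --> s^'+] --> sp_integral K Z s w.
Proof.
move=> s0.
have H a : Z (Num.min v a) w @[v --> s^'+] --> Z (Num.min s a) w.
  have [sa|as_] := ltP s a.
    apply: cvg_trans (@rZ w s s0); apply: near_eq_cvg; near=> v.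
    by rewrite min_l//; near: v; exact: nbhs_right_le.
  apply: (@cvg_near_cst R R); near=> v; rewrite min_r//.
  by rewrite (le_trans as_)//; near: v; exact: nbhs_right_ge.
apply: cvg_sumr => i; apply: cvgM; first exact: cvg_cst.
by apply: cvgB.
Unshelve. all: by end_near. Qed.

(** The value that the simple process takes just after [g], killed from [tau] on. The intervals are
    closed on the left, unlike those of [sp_process], because this coefficient multiplies the
    increment that follows [g]; membership is then decided at time [g]. *)
Definition sp_coef (tau : T -> R) (g : R) (w : T) : R := (g < tau w)%R%:R *
  \sum_(i < sp_size K) sp_val K i w * (sp_time K i w <= g < sp_time K i.+1 w)%R%:R.

Lemma sp_coef_gmeasurable tau g : stopping_time F tau -> 0 <= g ->
  gmeasurable_fun (F g) (sp_coef tau g).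
Proof.
move=> stau g0; have sF := filtration_sigma hF g0.
have mlt sigma : stopping_time F sigma ->
    gmeasurable_fun (F g) (fun w => (g < sigma w)%R%:R).
  move=> ssig; under eq_fun do rewrite ltNge.
  apply: gmeasurable_bool => //.
  rewrite (_ : [set w | _] = ~` [set w | sigma w <= g]).
    rewrite -(filtration_measurableE hF g0); apply: measurableC.
    by rewrite (filtration_measurableE hF g0); exact: ssig.2.
  by apply/seteqP; split => w /= /negP.
apply: measurable_funM; first exact: mlt.
apply: measurable_sum => i.
rewrite (_ : (fun w => _) = (fun w => (sp_val K i w * (sp_time K i w <= g)%R%:R) *
  (g < sp_time K i.+1 w)%R%:R)); last first.
  by apply/funext => w; rewrite -mulrA -natrM mulnb.
apply: measurable_funM; first exact: sp_val_gmeasurable.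
by apply: mlt; exact: sp_time_stopping.
Qed.

(** After exchanging the sums, the indicator of the i-th interval before [tau] is the difference of
    the indicators of times before [min(tau, T_{i+1})] and before [min(tau, T_i)]. Each of them is
    handled by [grid_sum_cvg]. *)
Lemma sp_integral_cvg t tau w : 0 <= tau w <= t ->
  (\sum_(k < N.+1) sp_coef tau (grid t N k) w *
      (Z (grid t N k.+1) w - Z (grid t N k) w)) @[N --> \oo]
  --> sp_integral K Z (tau w) w.
Proof.
move=> /andP[tau0 taut]; have t0 : 0 <= t by exact: le_trans taut.
have timeS i : (i < sp_size K)%N -> sp_time K i w <= sp_time K i.+1 w.
  by case: hK => _ + _ _ _ => /(_ i) H /H.
have time0 i : (i <= sp_size K)%N -> 0 <= sp_time K i w.
  by move=> /sp_time_stopping[].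
rewrite (_ : (fun N => _) = (fun N => \sum_(i < sp_size K) sp_val K i w *
   (grid_sum t (Z ^~ w) (Num.min (tau w) (sp_time K i.+1 w)) N -
    grid_sum t (Z ^~ w) (Num.min (tau w) (sp_time K i w)) N))); last first.
  apply/funext => N; rewrite /sp_coef /grid_sum.
  under eq_bigr do rewrite mulr_sumr mulr_suml.
  rewrite exchange_big/=; apply: eq_bigr => i _.
  rewrite -sumrB mulr_sumr; apply: eq_bigr => k _.
  rewrite !lt_min; set g := grid t N k.
  have : sp_time K i w <= sp_time K i.+1 w by exact: timeS.
  case: (ltP g (tau w)) => _ /=; last by rewrite !mul0r subrr mulr0.
  rewrite mul1r; case: (leP (sp_time K i w) g) => [_ _|gT TT] /=.
    by rewrite mul0r subr0 -mulrA.
  by rewrite (lt_le_trans gT TT) subrr !mulr0 mul0r.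
apply: cvg_sumr => i; apply: cvgM; first exact: cvg_cst.
have -> : Z (Num.min (tau w) (sp_time K i.+1 w)) w -
    Z (Num.min (tau w) (sp_time K i w)) w =
  (Z (Num.min (tau w) (sp_time K i.+1 w)) w - Z 0 w) -
    (Z (Num.min (tau w) (sp_time K i w)) w - Z 0 w) by ring.
apply: cvgB; apply: grid_sum_cvg; rewrite ?le_min ?ge_min ?taut ?tau0 ?time0//.
- by apply: rZ; rewrite le_min tau0 time0.
- exact: ltnW.
- by apply: rZ; rewrite le_min tau0 time0//; exact: ltnW.
Qed.

End simple_integrals.

Lemma measurable_exists {dT : measure_display} {T : measurableType dT}
    (I : finType) (A : I -> set T) : (forall i, measurable (A i)) ->
  measurable [set w | exists i, A i w].
Proof.
move=> mA; rewrite (_ : [set w | _] = \bigcup_(i in [set: I]) A i).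
  by apply: fin_bigcup_measurable => //; exact: finite_finset.
by apply/seteqP; split => w; [move=> [i Ai]; exists i|move=> [i _ Ai]; exists i].
Qed.

Lemma cvg_measure_exists {R : realType} {dT : measure_display}
    {T : measurableType dT} (mu : {measure set T -> \bar R}) (I : finType)
    (A : I -> nat -> set T) : (forall i m, measurable (A i m)) ->
  (forall i, mu (A i m) @[m --> \oo] --> 0%E) ->
  mu [set w | exists i, A i m w] @[m --> \oo] --> 0%E.
Proof.
move=> mA A0.
have le_sum (r : seq I) m : (mu (\big[setU/set0]_(i <- r) A i m) <=
    \sum_(i <- r) mu (A i m))%E.
  elim: r => [|i r IH]; first by rewrite !big_nil measure0.
  rewrite !big_cons (le_trans (measureU2 _ _ _))//.
    by apply: bigsetU_measurable.
  exact: leeD2l.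
have setE m : [set w | exists i, A i m w] = \big[setU/set0]_(i <- enum I) A i m.
  rewrite -bigcup_seq; apply/seteqP; split => w.
    by move=> [i Ai]; exists i => //=; rewrite mem_enum.
  by move=> [i _ Ai]; exists i.
apply: (@squeeze_cvge _ _ _ _ (cst 0%E) _ (fun m => \sum_(i <- enum I) mu (A i m))%E).
- by apply: nearW => m; rewrite measure_ge0/= setE le_sum.
- exact: cvg_cst.
- rewrite -[X in _ --> X](_ : (\sum_(i <- enum I) (0 : \bar R))%E = 0%E); last by rewrite big1.
  apply: cvg_nnesum => [i _|i _]; last exact: A0.
  exact: nearW.
Qed.

Lemma cvg_norm_le {R : realType} (u : nat -> R) (a b c : R) :
  u k @[k --> \oo] --> a -> (forall k, `|u k - b| <= c) -> `|a - b| <= c.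
Proof.
move=> ua uc; have H : `|u k - b| @[k --> \oo] --> `|a - b|.
  by apply: cvg_norm; apply: cvgB => //; exact: cvg_cst.
rewrite -(cvg_lim _ H)//; apply: limr_le.
  by apply/cvg_ex; eexists; exact: H.
exact: nearW.
Qed.

(** * The stopped solution *)

Section solution.
Context {R : realType} {dO : measure_display} {Omega : measurableType dO}.
Variables (P : probability Omega R) (F : R -> set_system Omega) (d n : nat).
Variables (Z : R -> Omega -> 'cV[R]_n) (psi : 'cV[R]_n -> R[i]).
Variables (Phi : 'cV[R]_d -> 'M[R]_(d, n)).
Variable X : R -> @Obar R dO Omega d -> 'cV[R]_d.
Hypothesis hF : filtration F.
Hypothesis hZ : levy_process P F Z.
Hypothesis hpsi : characteristic_exponent P Z psi.
Hypothesis hLip : locally_lipschitz Phi.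
Hypothesis cX : cadlag X.
Hypothesis aX : adapted (@Fbar R dO Omega F d) X.

Local Notation Obar := (@Obar R dO Omega d).
Local Notation Fbar := (@Fbar R dO Omega F d).
Local Notation Pbar := (@Pbar R dO Omega P d).

Let hFb : filtration Fbar := Fbar_filtration d hF.

Let Zbar l : R -> Obar -> R := fun t w => Z t w.2 l ord0.

Lemma Zbar_right l (w : Obar) s : 0 <= s -> Zbar l v w @[v --> s^'+] --> Zbar l s w.
Proof. by move=> s0; exact: (cvg_entry (levy_right_continuous hZ s0)). Qed.

Lemma Zbar_gmeasurable l s : 0 <= s -> gmeasurable_fun (Fbar s) (Zbar l s).
Proof.
move=> s0; apply/gmeasurable_funP; first exact: (filtration_sigma hFb).
move=> B mB u su; apply: sub_sigma_algebra.
exists setT; first by apply: sub_sigma_algebra; exact: openT.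
exists ((fun w => Z s w l ord0) @^-1` B).
  apply: (filtrationS hF s0 (ltW su)).
  have mZ := levy_gmeasurable hF hZ l s0.
  exact: ((gmeasurable_funP _ (filtration_sigma hF s0)).1 mZ).
by apply/seteqP; split => -[y w] /= => [[]|].
Qed.

Let V j l : R -> Obar -> R := fun t w => Phi (X t w) j l.
Let VL j l : R -> Obar -> R := fun t w => Phi (left_limit X t w) j l.

Let cPhi j l : continuous (fun y => Phi y j l).
Proof. exact: continuous_locally_lipschitz. Qed.

Lemma X_right (w : Obar) s : 0 <= s -> X v w @[v --> s^'+] --> X s w.
Proof. by move=> s0; exact: (cX w).1. Qed.

Lemma V_right j l (w : Obar) s : 0 <= s -> V j l v w @[v --> s^'+] --> V j l s w.
Proof.
move=> s0; apply: (@cvg_comp _ _ _ (fun v => X v w) (fun y => Phi y j l)).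
  exact: X_right.
exact: cPhi.
Qed.

Lemma V_left j l (w : Obar) s : 0 < s -> V j l v w @[v --> s^'-] --> VL j l s w.
Proof.
move=> s0; apply: (@cvg_comp _ _ _ (fun v => X v w) (fun y => Phi y j l)).
  exact: ((cX w).2 s s0).
by rewrite /VL /left_limit s0; exact: cPhi.
Qed.

Lemma V_gmeasurable j l s : 0 <= s -> gmeasurable_fun (Fbar s) (V j l s).
Proof.
move=> s0; apply: (@measurable_wrt_comp _ _ _ _ (X s) (fun y => Phi y j l)).
- exact: (filtration_sigma hFb).
- exact: aX.
- exact: cPhi.
Qed.

(** * Exit from a ball *)

Section exit.
Variable x : 'cV[R]_d.

Definition exit_set (r s : R) : set Obar := [set w | r < frobenius (X s w - x)].

Lemma continuous_frobeniusB : continuous (fun y : 'cV[R]_d => frobenius (y - x)).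
Proof.
move=> y; apply: (@cvg_comp _ _ _ (fun y : 'cV[R]_d => y - x) (@frobenius R d 1));
  last exact: continuous_frobenius.
by apply: (@cvgB _ _ _ (nbhs y) _ id (fun=> x)); [exact: cvg_id|exact: cvg_cst].
Qed.

Lemma exit_set_right_open r : right_open (exit_set r).
Proof.
move=> w s s0 rX.
have : frobenius (X v w - x) @[v --> s^'+] --> frobenius (X s w - x).
  apply: (@cvg_comp _ _ _ (fun v => X v w) (fun y => frobenius (y - x))).
    exact: X_right.
  exact: continuous_frobeniusB.
by move=> /cvgr_gt/(_ _ rX).
Qed.

Lemma exit_set_measurable r s : 0 <= s -> Fbar s (exit_set r s).
Proof.
move=> s0; apply: gmeasurable_lt; first exact: (filtration_sigma hFb).
  exact: measurable_cst.
apply: (@measurable_wrt_comp _ _ _ _ (X s) (fun y => frobenius (y - x))).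
- exact: (filtration_sigma hFb).
- exact: aX.
- exact: continuous_frobeniusB.
Qed.

Lemma exit_hit_stopping r t : 0 <= t -> stopping_time Fbar (hit (exit_set r) t).
Proof.
move=> t0; apply: (hit_stopping hFb) => //; first exact: exit_set_right_open.
by move=> s s0; exact: exit_set_measurable.
Qed.

(** The cutoff of [hit] at [t] is the minimum with [t] in [stopped]. That minimum lies between 0 and
    [t], so [fine] is applied to a finite value even when the path never exits. *)
Lemma stopped_exit_time r t w : 0 <= t ->
  stopped X (exit_time X x r) t w = X (hit (exit_set r) t w) w.
Proof.
move=> t0; rewrite /stopped; congr (X _ w).
set E := exit_time X x r w; set h := hit _ _ _.
have h0 : 0 <= h by exact: hit_ge0.
have hE : (h%:E <= E)%E.
  apply: le_ereal_inf_tmp => _ [s [s0 rX] <-]; rewrite lee_fin.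
  by apply: hit_le_in.
have ht : (h%:E <= t%:E)%E by rewrite lee_fin; exact: hit_le.
have hm : (h%:E <= Order.min t%:E E)%E by rewrite le_min ht hE.
have mt : (Order.min t%:E E <= t%:E)%E by rewrite ge_min lexx.
have mfin : Order.min t%:E E \is a fin_num.
  by rewrite ge0_fin_numE ?(le_lt_trans mt) ?ltry// (le_trans _ hm).
apply/eqP; rewrite eq_le; apply/andP; split; last first.
  by rewrite -lee_fin fineK.
apply: lb_le_inf; first by exists t; right.
move=> s [[s0 rX]|->]; rewrite -lee_fin fineK// ge_min ?lexx//.
by apply/orP; right; apply: ereal_inf_lbound; exists s.
Qed.

Lemma measurable_stopped_dot r t xi : 0 <= t ->
  measurable_fun setT (fun w => dot (X (hit (exit_set r) t w) w - x) xi).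
Proof.
move=> t0; rewrite (_ : (fun w => _) = (fun w => \sum_j
    (X (hit (exit_set r) t w) w j ord0 - x j ord0) * xi j ord0)); last first.
  by apply/funext => w; rewrite dotE; apply: eq_bigr => j _; rewrite !mxE.
apply: measurable_sum => j; apply: measurable_funM => //; apply: measurable_funB => //.
apply: (@stopped_measurable _ _ _ t (fun s w => X s w j ord0)).
- by move=> w s s0; exact: (cvg_entry (X_right s0)).
- move=> s s0; apply: (gmeasurable_fun_measurable hFb s0).
  apply: (@measurable_wrt_comp _ _ _ _ (X s) (fun y : 'cV[R]_d => y j ord0)).
  + exact: (filtration_sigma hFb).
  + exact: aX.
  + exact: coord_continuous.
- by move=> w; rewrite hit_ge0//= hit_le.
- move=> s s0; apply: (filtration_measurable hFb s0).
  exact: (exit_hit_stopping r t0).2.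
Qed.

Definition early_exit (r t : R) : set Obar :=
  [set w | exists s, [/\ 0 <= s, s <= t & exit_set r s w]].

Lemma early_exit_measurable r t : 0 <= t -> measurable (early_exit r t).
Proof.
move=> t0; rewrite (_ : early_exit r t =
    [set w | exists s, [/\ 0 <= s, s < t & exit_set r s w]] `|` exit_set r t).
  apply: measurableU; apply: (filtration_measurable hFb t0); last first.
    exact: exit_set_measurable.
  apply: (entry_measurable hFb) => //; first exact: exit_set_right_open.
  by move=> s s0 _; exact: exit_set_measurable.
apply/seteqP; split => w /=.
  move=> [s [s0]]; rewrite le_eqVlt => /predU1P[->|st] Ds; first by right.
  by left; exists s.
by move=> [[s [s0 /ltW st Ds]]|Dt]; [exists s|exists t].
Qed.

End exit.

(** * The solution started at a fixed point *)

Section start.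
Variable x : 'cV[R]_d.
Variable I : 'I_d -> 'I_n -> R -> Obar -> R.
Hypothesis hI : forall j l, is_stochastic_integral (Pbar x) Fbar (VL j l) (Zbar l) (I j l).
Hypothesis hXI : {ae Pbar x, forall w, forall t : R, 0 <= t -> forall j,
  X t w j ord0 = x j ord0 + \sum_k I j k t w}.

Lemma Pbar_setT : (Pbar x setT < +oo)%E.
Proof.
by rewrite PbarE// (le_lt_trans (probability_le1 _ _)) ?ltry//; exact: measurableT.
Qed.

(** The defining property of the stochastic integral turns ucp convergence of the integrands into
    ucp convergence of the integrals. *)
Lemma coefficient_approximation j l : exists K : nat -> simple_process Obar,
    [/\ forall m, simple_predictable Fbar (K m),
        cvg_ucp (Pbar x) (fun m => sp_integral (K m) (Zbar l)) (I j l),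
        forall m i w, sp_val (K m) i w = V j l (sp_time (K m) i w) w,
        forall m w, {homo (fun i => sp_time (K m) i w) : i j / (i <= j)%N >-> i <= j} &
        forall t, Pbar x [set w | sp_time (K m) (sp_size (K m)) w <= t]
          @[m --> \oo] --> 0%E].
Proof.
have [[cVL aVL] _ HI] := hI j l.
have [K [K1 K2 K3 K4 K5]] := @ucp_approximation _ _ _ _ _ Pbar_setT hFb (V j l) (VL j l)
  (@V_right j l) (@V_left j l) (fun w s s0 => (cVL w).1 s s0)
  (fun w => ltac:(by rewrite /VL /left_limit ltxx))
  (@V_gmeasurable j l) (fun s s0 => (measurable_wrtP _ (filtration_sigma hFb s0)).1 (aVL s s0)).
by exists K; split; [exact: K1|exact: HI K1 K2|exact: K3|exact: K4|exact: K5].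
Qed.

(** The integrals of simple processes vanish at time 0, and ucp convergence on the interval [[0, 0]]
    passes this to [I] outside a null set. *)
Lemma integral_at0 j l : {ae Pbar x, forall w, I j l 0 w = 0}.
Proof.
have [[cVL aVL] [cI aI] _] := hI j l.
have [K [K1 K2 _ _ _]] := coefficient_approximation j l.
have mI : measurable_fun setT (I j l 0).
  apply: (gmeasurable_fun_measurable hFb (lexx 0)).
  by apply/measurable_wrtP; [exact: (filtration_sigma hFb)|exact: aI].
have S0 m w : sp_integral (K m) (Zbar l) 0 w = 0.
  rewrite /sp_integral big1// => i _.
  have T0 k : (k <= sp_size (K m))%N -> Num.min 0 (sp_time (K m) k w) = 0.
    by move=> kK; rewrite min_l//; exact: (sp_time_stopping (K1 m) kK).1.
  by rewrite !T0 ?subrr ?mulr0//; exact: ltnW.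
pose A k := [set w | k.+1%:R^-1 < `|I j l 0 w|].
have mA k : measurable (A k).
  rewrite -[X in measurable X]setTI; apply: measurable_fun_ltr => //.
  exact: measurableT_comp.
have A0 k : Pbar x (A k) = 0%E.
  have k0 : 0 < k.+1%:R^-1 :> R by rewrite invr_gt0.
  have := K2 0 k.+1%:R^-1 (lexx 0) k0.
  (* On [[0, 0]] the deviation is just the absolute value of [I] at 0, whatever [m] is: a constant
     sequence that tends to 0. *)
  rewrite (_ : (fun m => _) = fun=> Pbar x (A k)); last first.
    apply/funext => m; congr (Pbar x _); apply/seteqP; split => w /=.
      move=> /lt_ereal_sup_itv[s [s0 s0' H]].
      have {s0 s0'} s0 : s = 0 by apply/eqP; rewrite eq_le s0 s0'.
      by move: H; rewrite s0 S0 sub0r normrN.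
    move=> H; apply/lt_ereal_sup_itv; exists 0; split => //.
    by rewrite S0 sub0r normrN.
  by move=> /(cvg_unique _ (cvg_cst _)) => ->.
have nA k : (Pbar x).-negligible (A k) by exists (A k); split.
have [N [mN N0 AN]] := negligible_bigcup nA.
exists N; split => //; apply: subset_trans AN.
move=> w /= /eqP; rewrite -normr_gt0 => I0.
by have [k] := ltr_add_invr I0; rewrite add0r => ?; exists k.
Qed.

(** The initial condition is the integral equation read at time 0. *)
Lemma start_point : {ae Pbar x, forall w, X 0 w = x}.
Proof.
have H : {ae Pbar x, forall w, forall jl : 'I_d * 'I_n, I jl.1 jl.2 0 w = 0}.
  by apply: filter_forall => -[j l]; exact: integral_at0.
apply: filterS2 hXI H => w XI I0; apply/matrixP => j k; rewrite ord1.
by rewrite XI// big1 ?addr0// => l _; exact: (I0 (j, l)).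
Qed.

(** Continuity from above along the times [1 / (k + 1)]: a path in all these events leaves the ball
    arbitrarily early, which right continuity forbids when it starts at [x]. *)
Lemma early_exit_cvg0 (r e : R) : 0 < r -> 0 < e ->
  exists2 t0 : R, 0 < t0 & forall t, 0 <= t -> t <= t0 ->
    fine (P [set w | early_exit x r t (x, w)]) <= e.
Proof.
move=> r0 e0; pose E k := early_exit x r k.+1%:R^-1.
have k0 k : 0 <= k.+1%:R^-1 :> R by rewrite invr_ge0.
have mE k : measurable (E k) by exact: early_exit_measurable.
have sub s t : s <= t -> early_exit x r s `<=` early_exit x r t.
  by move=> st w [v [v0 vs Dv]]; exists v; split => //; exact: le_trans st.
have : Pbar x (E k) @[k --> \oo] --> Pbar x (\bigcap_k E k).
  apply: nonincreasing_cvg_mu => //.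
  - by rewrite (le_lt_trans _ Pbar_setT)// le_measure// inE.
  - exact: bigcapT_measurable.
  - move=> a b ab; apply/subsetPset; apply: sub.
    by rewrite lef_pV2 ?posrE// ler_nat.
have -> : Pbar x (\bigcap_k E k) = 0%E.
  have [N [mN N0 XN]] := start_point.
  apply: (subset_measure0 _ mN _ N0); first exact: bigcapT_measurable.
  apply: subset_trans XN => w Ew /= X0.
  have : frobenius (X v w - x) @[v --> 0^'+] --> frobenius (X 0 w - x).
    apply: (@cvg_comp _ _ _ (fun v => X v w) (fun y => frobenius (y - x))).
      exact: X_right.
    exact: continuous_frobeniusB.
  rewrite X0 subrr frobenius0 => /cvgr_lt/(_ _ r0)[dl /= dl0 Hdl].
  have [k] := ltr_add_invr dl0; rewrite add0r => kdl.
  have [s [s0 sk Ds]] := Ew k Logic.I.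
  suff : frobenius (X s w - x) < r by rewrite ltNge ltW.
  move: s0; rewrite le_eqVlt => /predU1P[<-|s0]; first by rewrite X0 subrr frobenius0.
  by apply: Hdl => //=; rewrite sub0r normrN gtr0_norm// (le_lt_trans sk).
move=> /(_ [set y | (y < e%:E)%E]) []; first by apply: open_ereal_lt'; rewrite lte_fin.
move=> k _ /(_ k (leqnn k)) /= Ek.
exists k.+1%:R^-1; first by rewrite invr_gt0.
move=> t t0 tk; rewrite -PbarE; last exact: early_exit_measurable.
have le_e : (Pbar x (early_exit x r t) <= e%:E)%E.
  apply: le_trans (ltW Ek); rewrite le_measure ?inE//.
    exact: early_exit_measurable.
  exact: sub.
rewrite -lee_fin fineK// ge0_fin_numE//; exact: le_lt_trans le_e (ltry _).
Qed.

Let K j l : nat -> simple_process Obar :=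
  projT1 (cid (coefficient_approximation j l)).

Let KP j l := projT2 (cid (coefficient_approximation j l)).

(** The bound [s < tau w] is the point: when [tau] is an exit time, the sampled value comes from
    inside the ball. *)
Lemma sp_coef_value j l m (tau : Obar -> R) g w :
  sp_coef (K j l m) tau g w = 0 \/
  exists s, [/\ 0 <= s, s <= g, s < tau w & sp_coef (K j l m) tau g w = V j l s w].
Proof.
have [K1 _ K3 K4 _] := KP j l.
rewrite /sp_coef; have [gtau|_] := ltP g (tau w); last by left; rewrite mul0r.
rewrite mul1r.
have [->|[i [iK ig ->]]] := sum_interval_cases (fun i => sp_val (K j l m) i w) g
    (K4 m w) (sp_size (K j l m)); [by left|right].
exists (sp_time (K j l m) i w); split => //.
- exact: (sp_time_stopping (K1 m) (ltnW iK)).1.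
- exact: le_lt_trans gtau.
- exact: K3.
Qed.

(** Before [tau] and before the last partition time, the alternative 0 of [sp_coef_value] is
    excluded. *)
Lemma sp_coef_value_lt j l m (tau : Obar -> R) g w : 0 <= g -> g < tau w ->
  g < sp_time (K j l m) (sp_size (K j l m)) w ->
  exists s, [/\ 0 <= s, s <= g & sp_coef (K j l m) tau g w = V j l s w].
Proof.
move=> g0 gtau gT; have [K1 _ K3 K4 _] := KP j l.
have T0 : sp_time (K j l m) 0 w <= g by case: (K1 m) => ->.
have [i iK ig] := @interval_exists _ (fun i => sp_time (K j l m) i w) g _ T0 gT.
exists (sp_time (K j l m) i w); split.
- exact: (sp_time_stopping (K1 m) (ltnW iK)).1.
- by case/andP: ig.
- rewrite /sp_coef gtau mul1r.
  by rewrite (sum_interval (fun i => sp_val (K j l m) i w) (K4 m w) iK ig) K3.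
Qed.

Lemma measurable_fun_section (f : Obar -> R) : measurable_fun setT f ->
  measurable_fun setT (fun w => f (x, w)).
Proof.
move=> mf _ B mB; rewrite setTI; apply: (measurable_section x (A := f @^-1` B)).
by rewrite -[X in measurable X]setTI; exact: mf.
Qed.

Lemma section_cvg0 (A : nat -> set Obar) : (forall m, measurable (A m)) ->
  Pbar x (A m) @[m --> \oo] --> 0%E ->
  fine (P [set w | A m (x, w)]) @[m --> \oo] --> (0 : R).
Proof.
by move=> mA A0; apply: fine_cvg; under eq_fun do rewrite -PbarE//.
Qed.

(** * The estimate at a fixed time *)

Section estimate.
Variables (xi : 'cV[R]_d) (r dl t e C : R).
Hypotheses (dlr : dl <= r) (t_gt0 : 0 < t) (e0 : 0 <= e) (C0 : 0 <= C).

Let t0 : 0 <= t := ltW t_gt0.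

Let psi_dist (eta : 'cV[R]_n) :=
  `|complex.Re (psi eta) - complex.Re (psi ((Phi x)^T *m xi))| +
  `|complex.Im (psi eta) - complex.Im (psi ((Phi x)^T *m xi))|.

(** The point [y] depends on the entry: each entry of [Phi] has its own approximating sequence and
    stopping times, so a frozen matrix mixes values of [Phi] at different points of the path. In
    [Hbad] an entry may also be 0, as after [tau] or once the partition has run out. *)
Hypothesis Hgood : forall A : 'M[R]_(d, n),
  (forall j l, exists2 y, frobenius (y - x) <= dl & A j l = Phi y j l) ->
  psi_dist (A^T *m xi) <= e.
Hypothesis Hbad : forall A : 'M[R]_(d, n),
  (forall j l, A j l = 0 \/
     exists2 y, frobenius (y - x) <= r & A j l = Phi y j l) ->
  psi_dist (A^T *m xi) <= C.

Let tau : Obar -> R := hit (exit_set x r) t.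

Let tau_bound w : 0 <= tau w <= t.
Proof. by rewrite hit_ge0//= hit_le. Qed.

Let tau_stop : stopping_time Fbar tau.
Proof. exact: exit_hit_stopping. Qed.

(** The event that some partition runs out by time [t]; from there on, the coefficient is 0 and need
    not be close to [Phi x]. *)
Let short m : set Obar := [set w | exists jl : 'I_d * 'I_n,
  sp_time (K jl.1 jl.2 m) (sp_size (K jl.1 jl.2 m)) w <= t].

Let short_measurable m : measurable (short m).
Proof.
apply: (measurable_exists (A := fun jl : 'I_d * 'I_n => [set w |
  sp_time (K jl.1 jl.2 m) (sp_size (K jl.1 jl.2 m)) w <= t])) => -[j l].
have [K1 _ _ _ _] := KP j l.
apply: (filtration_measurable hFb t0).
exact: (sp_time_stopping (K1 m) (leqnn _)).2.
Qed.

Let A m g w : 'M[R]_(d, n) := \matrix_(j, l) sp_coef (K j l m) tau g w.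

Let psi_dist_bound m N k w : (k < N.+1)%N ->
  psi_dist ((A m (grid t N k) w)^T *m xi) <=
    e + C * \1_(early_exit x dl t `|` short m) w.
Proof.
move=> kN; set g := grid t N k.
have g0 : 0 <= g by exact: grid_ge0.
have gt_ : g <= t by rewrite -(grid_last t N); apply: le_grid => //; exact: ltnW.
rewrite indicE; have [_|] := boolP (w \in _).
  rewrite mulr1; apply: (@le_trans _ _ C); last by rewrite lerDr.
  apply: Hbad => j l; rewrite mxE.
  have [->|[s [s0 _ stau ->]]] := sp_coef_value j l m tau g w; [by left|right].
  exists (X s w) => //; rewrite leNgt; apply/negP.
  exact: (hit_notin t0 s0 stau).
rewrite mulr0 addr0 => /negP; rewrite inE /= => /not_orP[nE nS].
have nexit s : 0 <= s -> s <= t -> frobenius (X s w - x) <= dl.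
  move=> s0 st; rewrite leNgt; apply/negP => H; apply: nE.
  by exists s.
apply: Hgood => j l; rewrite mxE.
(* Without an exit from the ball of radius [dl <= r], the hitting time is the cutoff [t], and a grid
   point of index below [N + 1] is strictly before [t]. *)
have gtau : g < tau w.
  apply: (lt_le_trans (grid_lt t_gt0 kN)); rewrite leNgt; apply/negP.
  move=> /(hit_ltP _ t0 _ _).1 [|[s [s0 st Ds]]]; first by rewrite ltxx.
  by move: Ds; rewrite /exit_set /= ltNge (le_trans (nexit s s0 (ltW st))).
have gT : g < sp_time (K j l m) (sp_size (K j l m)) w.
  apply: le_lt_trans gt_ _; rewrite ltNge; apply/negP => H; apply: nS.
  by exists (j, l).
have [s [s0 sg ->]] := sp_coef_value_lt g0 gtau gT.
by exists (X s w) => //; apply: nexit => //; exact: le_trans gt_.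
Qed.

Let Y m (w : Obar) : R := \sum_j \sum_l
  xi j ord0 * sp_integral (K j l m) (Zbar l) (tau w) w.

(** Transposition moves [xi] from the integral to the coefficients, which gives the sums the form
    required by [discrete_exponential_approx]. *)
Let Y_cvg m w :
  (\sum_(k < N.+1) dot (Z (grid t N k.+1) w - Z (grid t N k) w)
     ((A m (grid t N k) (x, w))^T *m xi)) @[N --> \oo] --> Y m (x, w).
Proof.
rewrite (_ : (fun N => _) = (fun N => \sum_j \sum_l xi j ord0 *
   \sum_(k < N.+1) sp_coef (K j l m) tau (grid t N k) (x, w) *
      (Zbar l (grid t N k.+1) (x, w) - Zbar l (grid t N k) (x, w)))); last first.
  apply/funext => N; transitivity (\sum_(k < N.+1) \sum_j \sum_l xi j ord0 *
     (sp_coef (K j l m) tau (grid t N k) (x, w) *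
      (Zbar l (grid t N k.+1) (x, w) - Zbar l (grid t N k) (x, w)))).
    apply: eq_bigr => k _; rewrite dotE exchange_big/=; apply: eq_bigr => l _.
    rewrite !mxE mulr_sumr; apply: eq_bigr => j _; rewrite !mxE /Zbar /=; ring.
  rewrite exchange_big/=; apply: eq_bigr => j _.
  rewrite exchange_big/=; apply: eq_bigr => l _.
  by rewrite mulr_sumr.
apply: cvg_sumr => j; apply: cvg_sumr => l; apply: cvgM; first exact: cvg_cst.
have [K1 _ _ _ _] := KP j l.
apply: (sp_integral_cvg (K1 m)); last exact: tau_bound.
by move=> w' s s0; exact: Zbar_right.
Qed.

Let mY m : measurable_fun setT (Y m).
Proof.
apply: measurable_sum => j; apply: measurable_sum => l; apply: measurable_funM => //.
have [K1 _ _ _ _] := KP j l.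
apply: (@stopped_measurable _ _ _ t (sp_integral (K j l m) (Zbar l))) => //.
- move=> w s s0; apply: sp_integral_right => //.
  by move=> w' s' s'0; exact: Zbar_right.
- move=> s s0; apply: (sp_integral_measurable hFb (K1 m)) => //.
    by move=> w' s' s'0; exact: Zbar_right.
  by move=> s' s'0; exact: Zbar_gmeasurable.
- by move=> s s0; apply: (filtration_measurable hFb s0); exact: tau_stop.2.
Qed.

Let target p := expR (- (t * complex.Re (psi ((Phi x)^T *m xi)))) *
  cos (t * complex.Im (psi ((Phi x)^T *m xi)) + p).

(** The bound for the grid sums involves a bad event that does not depend on the grid, so it
    survives the limit in [N] with [m] fixed. *)
Let simple_estimate m p : `|\int[P]_w cos (Y m (x, w) - p) - target p| <=
  t * (e + C * fine (P [set w | (early_exit x dl t `|` short m) (x, w)])).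
Proof.
have mB : measurable (early_exit x dl t `|` short m).
  by apply: measurableU => //; exact: early_exit_measurable.
pose YN N w := \sum_(k < N.+1) dot (Z (grid t N k.+1) w - Z (grid t N k) w)
     ((A m (grid t N k) (x, w))^T *m xi).
have meta N k l : gmeasurable_fun (F (grid t N k))
    (fun w => ((A m (grid t N k) (x, w))^T *m xi) l ord0).
  rewrite (_ : (fun w => _) = (fun w => \sum_j
      sp_coef (K j l m) tau (grid t N k) (x, w) * xi j ord0)); last first.
    by apply/funext => w; rewrite mxE; apply: eq_bigr => j _; rewrite !mxE.
  have g0 := grid_ge0 N k t0.
  apply: measurable_sum => j; apply: measurable_funM; last exact: measurable_cst.
  have [K1 _ _ _ _] := KP j l.
  by apply: (gmeasurable_section hF x g0); exact: (sp_coef_gmeasurable hFb (K1 m)).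
apply: (@cvg_norm_le _ (fun N => \int[P]_w cos (YN N w - p))); last first.
  move=> N; apply: (discrete_exponential_approx hF hZ hpsi t0 C0
    (measurable_section x mB) (meta N)).
  by move=> k w kN; have := psi_dist_bound m (x, w) kN; rewrite !indicE.
have mYN N : measurable_fun setT (YN N).
  apply: measurable_sum => k.
  rewrite (_ : (fun w => _) = (fun w => \sum_l (Z (grid t N k.+1) w l ord0 -
     Z (grid t N k) w l ord0) * ((A m (grid t N k) (x, w))^T *m xi) l ord0)); last first.
    by apply/funext => w; rewrite dotE; apply: eq_bigr => l _; rewrite !mxE.
  apply: measurable_sum => l; apply: measurable_funM.
    by apply: measurable_funB; apply: (levy_measurable hF hZ); exact: grid_ge0.
  by apply: (gmeasurable_fun_measurable hF (grid_ge0 N k t0)); exact: meta.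
have mYx := measurable_fun_section (mY m).
apply: (@bounded_cvg_Rintegral _ _ _ P _ _ 1).
- by move=> N; apply: measurableT_comp measurable_cos _; exact: measurable_funB.
- by apply: measurableT_comp measurable_cos _; exact: measurable_funB.
- by move=> N w; rewrite cos_max.
- apply/aeW => w; apply: (@cvg_comp _ _ _ _ (@cos R)); last exact: continuous_cos.
  by apply: cvgB; [exact: Y_cvg|exact: cvg_cst].
Qed.

Let Yoo (w : Obar) : R := \sum_j \sum_l xi j ord0 * I j l (tau w) w.

Let I_right j l (w : Obar) s : 0 <= s -> I j l v w @[v --> s^'+] --> I j l s w.
Proof. by move=> s0; have [_ [cI _] _] := hI j l; exact: (cI w).1. Qed.

Let I_measurable j l s : 0 <= s -> measurable_fun setT (I j l s).
Proof.
move=> s0; have [_ [_ aI] _] := hI j l.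
apply: (gmeasurable_fun_measurable hFb s0).
by apply/measurable_wrtP; [exact: (filtration_sigma hFb)|exact: aI].
Qed.

Let tau_measurable s : 0 <= s -> measurable [set w | tau w <= s].
Proof. by move=> s0; apply: (filtration_measurable hFb s0); exact: tau_stop.2. Qed.

Let mYoo : measurable_fun setT Yoo.
Proof.
apply: measurable_sum => j; apply: measurable_sum => l; apply: measurable_funM => //.
exact: (stopped_measurable (@I_right j l) (@I_measurable j l) tau_bound tau_measurable).
Qed.

(** The distance is uniform over [[0, t]], so that off this event the integrals may be compared at
    the random time [tau]. *)
Let far (eps : R) m : set Obar := [set w | exists jl : 'I_d * 'I_n,
  (eps%:E < ereal_sup [set `|sp_integral (K jl.1 jl.2 m) (Zbar jl.2) s w -
     I jl.1 jl.2 s w|%:E | s in [set` `[0, t]%R]])%E].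

Let far1_measurable eps m j l : measurable [set w | (eps%:E < ereal_sup
  [set `|sp_integral (K j l m) (Zbar l) s w - I j l s w|%:E | s in [set` `[0, t]%R]])%E].
Proof.
have [K1 _ _ _ _] := KP j l.
apply: (measurable_sup_right (A := fun s w => sp_integral (K j l m) (Zbar l) s w - I j l s w)) => //.
  move=> s s0; apply: measurable_funB; last exact: I_measurable.
  apply: (sp_integral_measurable hFb (K1 m)) => //.
    by move=> w' s' s'0; exact: Zbar_right.
  by move=> s' s'0; exact: Zbar_gmeasurable.
move=> w s s0; apply: cvgB; last exact: I_right.
by apply: sp_integral_right => // w' s' s'0; exact: Zbar_right.
Qed.

Let far_measurable eps m : measurable (far eps m).
Proof.
by apply: (measurable_exists (A := fun jl : 'I_d * 'I_n => [set w |
  (eps%:E < ereal_sup [set `|sp_integral (K jl.1 jl.2 m) (Zbar jl.2) s w -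
     I jl.1 jl.2 s w|%:E | s in [set` `[0, t]%R]])%E])) => -[j l].
Qed.

Let far_cvg0 eps : 0 < eps ->
  fine (P [set w | far eps m (x, w)]) @[m --> \oo] --> (0 : R).
Proof.
move=> eps0; apply: section_cvg0 => //.
apply: (cvg_measure_exists (A := fun (jl : 'I_d * 'I_n) m => [set w |
  (eps%:E < ereal_sup [set `|sp_integral (K jl.1 jl.2 m) (Zbar jl.2) s w -
     I jl.1 jl.2 s w|%:E | s in [set` `[0, t]%R]])%E])) => // -[j l].
have [_ K2 _ _ _] := KP j l.
exact: K2.
Qed.

Let short_cvg0 : fine (P [set w | short m (x, w)]) @[m --> \oo] --> (0 : R).
Proof.
apply: section_cvg0 => //.
apply: (cvg_measure_exists (A := fun (jl : 'I_d * 'I_n) m => [set w |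
  sp_time (K jl.1 jl.2 m) (sp_size (K jl.1 jl.2 m)) w <= t])) => -[j l] /=.
  move=> m; have [K1 _ _ _ _] := KP j l.
  apply: (filtration_measurable hFb t0).
  exact: (sp_time_stopping (K1 m) (leqnn _)).2.
have [_ _ _ _ K5] := KP j l.
exact: K5.
Qed.

Let Xi := \sum_(j < d) \sum_(l < n) `|xi j ord0|.

Let Y_close eps m w : 0 <= eps -> ~ far eps m w -> `|Yoo w - Y m w| <= Xi * eps.
Proof.
move=> eps0 nfar; rewrite /Yoo /Y -sumrB /Xi mulr_suml.
apply: le_trans (ler_norm_sum _ _ _) _; apply: ler_sum => j _.
rewrite -sumrB mulr_suml.
apply: le_trans (ler_norm_sum _ _ _) _; apply: ler_sum => l _.
rewrite -mulrBr normrM ler_wpM2l// distrC leNgt; apply/negP => H.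
apply: nfar; exists (j, l); apply/lt_ereal_sup_itv; exists (tau w).
by have /andP[-> ->] := tau_bound w.
Qed.

(** As [m] grows, the probabilities of [far] and [short] vanish and only the early exit remains. The
    slack [u] absorbs the tolerance [eps] in the comparison of the integrals. *)
Let limit_estimate p : `|\int[P]_w cos (Yoo (x, w) - p) - target p| <=
  t * (e + C * fine (P [set w | early_exit x dl t (x, w)])).
Proof.
apply/ler_addgt0Pr => u u0.
have Xi0 : 0 <= Xi by rewrite sumr_ge0// => j _; rewrite sumr_ge0.
(* Chosen so that [Xi * eps <= u]; the summand 1 guards against [xi = 0]. *)
pose eps := u / (Xi + 1).
have eps0 : 0 < eps by rewrite divr_gt0// ltr_wpDl.
have Xieps : Xi * eps <= u.
  by rewrite /eps mulrA ler_pdivrMr ?ltr_wpDl// mulrC ler_wpM2l ?ltW// ltrDl.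
have mE : measurable [set w | early_exit x dl t (x, w)].
  by apply: measurable_section; exact: early_exit_measurable.
have mS m : measurable [set w | short m (x, w)] by exact: measurable_section.
have mF m : measurable [set w | far eps m (x, w)] by exact: measurable_section.
have mcos (f : Obar -> R) : measurable_fun setT f ->
    measurable_fun setT (fun w => cos (f (x, w) - p)).
  move=> mf; apply: measurableT_comp measurable_cos _; apply: measurable_funB => //.
  exact: measurable_fun_section.
pose rhs m := (Xi * eps + 2 * fine (P [set w | far eps m (x, w)])) +
  t * (e + C * (fine (P [set w | early_exit x dl t (x, w)]) +
                fine (P [set w | short m (x, w)]))).
have rhs_cvg : rhs m @[m --> \oo] --> (Xi * eps + 2 * 0) +
  t * (e + C * (fine (P [set w | early_exit x dl t (x, w)]) + 0)).
  apply: cvgD.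
    by apply: cvgD; [exact: cvg_cst|apply: cvgM; [exact: cvg_cst|exact: far_cvg0]].
  apply: cvgM; first exact: cvg_cst.
  apply: cvgD; first exact: cvg_cst.
  apply: cvgM; first exact: cvg_cst.
  by apply: cvgD; first exact: cvg_cst.
have le_rhs m : `|\int[P]_w cos (Yoo (x, w) - p) - target p| <= rhs m.
  apply: (le_trans (ler_distD (\int[P]_w cos (Y m (x, w) - p)) _ _)).
  apply: lerD.
    apply: (@Rintegral_dist_le _ _ _ P _ _ 1) => //.
    - exact: mcos.
    - exact: mcos.
    - by move=> w; rewrite cos_max.
    - by move=> w; rewrite cos_max.
    move=> w; rewrite indicE; have [_|] := boolP (w \in _).
      rewrite mulr1; apply: (@le_trans _ _ 2); last by rewrite lerDr mulr_ge0// ltW.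
      by rewrite (le_trans (ler_normB _ _))// (_ : 2 = 1 + 1)// lerD// cos_max.
    move=> /negP; rewrite inE /= => nfar; rewrite mulr0 addr0.
    apply: (le_trans (cos_lipschitz _ _)); rewrite opprB addrA subrK.
    by apply: Y_close => //; exact: ltW.
  (* What remains is the union bound for the early exit and [short]. *)
  apply: (le_trans (simple_estimate m p)); rewrite ler_wpM2l// lerD2l ler_wpM2l//.
  rewrite -fineD ?fin_num_measure// fine_le ?fin_num_measure//.
  - exact: (measurableU _ _ mE (mS m)).
  - by rewrite fin_numD !fin_num_measure.
  - exact: (measureU2 P mE (mS m)).
have : `|\int[P]_w cos (Yoo (x, w) - p) - target p| <= limn rhs.
  by apply: limr_ge; [exact: cvgP rhs_cvg|exact: nearW].
rewrite (cvg_lim _ rhs_cvg)// mulr0 !addr0 => /le_trans; apply.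
by rewrite addrC lerD2l.
Qed.

(** Outside one null set the integral equation holds at all times simultaneously, so it may be read
    at the random time [tau]. *)
Lemma stopped_estimate p :
  `|\int[P]_w cos (dot (X (hit (exit_set x r) t (x, w)) (x, w) - x) xi - p) -
    target p| <= t * (e + C * fine (P [set w | early_exit x dl t (x, w)])).
Proof.
apply: le_trans (limit_estimate p).
rewrite le_eqVlt; apply/orP; left; apply/eqP; congr (`|_ - _|).
apply: ae_eq_Rintegral.
- apply: measurableT_comp measurable_cos _; apply: measurable_funB => //.
  exact: (measurable_fun_section (measurable_stopped_dot x r xi t0)).
- apply: measurableT_comp measurable_cos _; apply: measurable_funB => //.
  exact: (measurable_fun_section mYoo).
- have := ae_section hXI; apply: filterS => w XI; congr (cos (_ - _)).
  have /andP[tau0 _] := tau_bound (x, w).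
  rewrite dotE; apply: eq_bigr => j _; rewrite !mxE (XI _ tau0).
  by rewrite addrAC subrr add0r mulr_suml; apply: eq_bigr => l _; rewrite mulrC.
Qed.

End estimate.

(** * Bounds on the coefficients and choice of the constants *)

Hypothesis hgrowth : exists2 L : R, 0 < L &
  forall y, frobenius (Phi y) ^+ 2 <= L * (1 + frobenius y ^+ 2).

Lemma coefficient_bounded (r : R) : exists2 b : R, 0 <= b &
  forall (y : 'cV[R]_d) j l, frobenius (y - x) <= r -> `|Phi y j l| <= b.
Proof.
have [L L0 growth] := hgrowth.
pose S := \sum_(i < d) \sum_(j < 1) (`|x i j| + r) ^+ 2.
have S0 : 0 <= S by do 2 apply: sumr_ge0 => ? _; exact: sqr_ge0.
have b0 : 0 <= L * (1 + S).
  by apply: mulr_ge0; [exact: ltW|exact: addr_ge0].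
(* A nonnegative number is at most 1 or at most its square, so adding 1 to the bound for the square
   avoids a square root. *)
exists (1 + L * (1 + S)) => [|y j l yr]; first by rewrite addr_ge0.
have yx i k : `|y i k| <= `|x i k| + r.
  have -> : y i k = x i k + (y - x) i k by rewrite !mxE; ring.
  rewrite (le_trans (ler_normD _ _))// lerD2l (le_trans _ yr)//.
  exact: entry_le_frobenius.
have yS : frobenius y ^+ 2 <= S.
  rewrite sqr_sqrtr; last by do 2 apply: sumr_ge0 => ? _; exact: sqr_ge0.
  apply: ler_sum => i _; apply: ler_sum => k _.
  rewrite -(real_normK (num_real (y i k))) ler_sqr ?nnegrE//.
  exact: le_trans (yx i k).
have Phi2 : frobenius (Phi y) ^+ 2 <= L * (1 + S).
  by rewrite (le_trans (growth y))// (ler_wpM2l (ltW L0))// lerD2l.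
apply: le_trans (entry_le_frobenius (Phi y) j l) _.
have [le1|/ltW ge1] := leP (frobenius (Phi y)) 1.
  by rewrite (le_trans le1)// lerDl.
by rewrite (le_trans _ (le_trans Phi2 _)) ?lerDr// ler_eXnr.
Qed.

Lemma coefficient_near (k : R) : 0 < k -> exists2 dl : R, 0 < dl &
  forall (y : 'cV[R]_d) j l, frobenius (y - x) <= dl -> `|Phi y j l - Phi x j l| <= k.
Proof.
move=> k0.
have : \forall y \near x, forall jl : 'I_d * 'I_n,
    `|Phi x jl.1 jl.2 - Phi y jl.1 jl.2| < k.
  apply: (@filter_forall _ _ (fun jl y => `|Phi x jl.1 jl.2 - Phi y jl.1 jl.2| < k)
    (nbhs x)) => -[j l].
  by move/cvgrPdist_lt : (@cPhi j l x); exact.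
(* The ball is open and taken in the maximum norm, whereas the conclusion has a weak inequality in
   the Frobenius norm; halving the radius bridges both. *)
move=> /nbhs_ballP[u /= u0 Hu]; exists (u / 2); first by rewrite divr_gt0.
move=> y j l yx; rewrite distrC ltW//; apply: (Hu y _ (j, l)).
split=> // i c; rewrite /ball/= distrC.
have := entry_le_frobenius (y - x) i c; rewrite !mxE => /le_lt_trans; apply.
by rewrite (le_lt_trans yx)// ltr_pdivrMr// ltr_pMr// ltr1n.
Qed.

Lemma transpose_mul_entry_le (A : 'M[R]_(d, n)) (xi : 'cV[R]_d) (b : R) l :
  (forall j, `|A j l| <= b) ->
  `|(A^T *m xi) l ord0| <= b * \sum_j `|xi j ord0|.
Proof.
move=> Ab; rewrite mxE (le_trans (ler_norm_sum _ _ _))// mulr_sumr.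
by apply: ler_sum => j _; rewrite mxE normrM ler_wpM2r.
Qed.

(** One half of [u] pays for the continuity of [psi] near [Phi(x)^T xi], the other for the early
    exit. A tolerance [k] on frequencies becomes [k / (S + 1)] on entries of [Phi], with [S] the sum
    of the absolute entries of [xi]. The time [t0] does not depend on the phase [p]. *)
Lemma stopped_asymptotics (xi : 'cV[R]_d) (r u : R) : 0 < r -> 0 < u ->
  exists2 t0 : R, 0 < t0 & forall t p, 0 < t -> t <= t0 ->
  `|\int[P]_w cos (dot (X (hit (exit_set x r) t (x, w)) (x, w) - x) xi - p) -
    expR (- (t * complex.Re (psi ((Phi x)^T *m xi)))) *
      cos (t * complex.Im (psi ((Phi x)^T *m xi)) + p)| <= t * u.
Proof.
move=> r0 u0; set eta0 := _ *m xi.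
have u20 : 0 < u / 2 by rewrite divr_gt0.
have [k k0 Hk] := exponent_continuous hF hZ hpsi eta0 u20.
pose S := \sum_j `|xi j ord0|.
have S0 : 0 <= S by apply: sumr_ge0.
have kS0 : 0 < k / (S + 1) by rewrite divr_gt0// ltr_wpDl.
have [dl dl0 Hdl] := coefficient_near kS0.
have [b b0 Hb] := coefficient_bounded r.
have [C HC] := exponent_bounded hF hZ hpsi (b * S).
(* The triangle inequality bounds the distance of any admissible exponent to [psi eta0]; the
   absolute value of [C] makes the constant visibly nonnegative. *)
pose C' := `|C| + (`|complex.Re (psi eta0)| + `|complex.Im (psi eta0)|).
have C'0 : 0 <= C' by rewrite !addr_ge0.
pose dl' := Num.min dl r.
have dl'0 : 0 < dl' by rewrite lt_min dl0.
have v0 : 0 < u / 2 / (C' + 1) by rewrite divr_gt0// ltr_wpDl.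
have [t0 t00 Ht0] := early_exit_cvg0 dl'0 v0.
exists t0 => // t p t_gt0 tt0.
have dlr : dl' <= r by rewrite ge_min lexx orbT.
apply: le_trans (@stopped_estimate xi r dl' t (u / 2) C' dlr t_gt0 (ltW u20) C'0 _ _ p) _.
- move=> A HA; apply: Hk => l.
  rewrite -[X in _ - X]mulr1 mulr1 (_ : _ - _ = ((A - Phi x)^T *m xi) l ord0); last first.
    by rewrite linearB/= mulmxBl !mxE.
  apply: le_trans (@transpose_mul_entry_le _ _ (k / (S + 1)) _ _) _.
    move=> j; rewrite !mxE; have [y yx ->] := HA j l; apply: Hdl.
    by rewrite (le_trans yx)// ge_min lexx.
  by rewrite -/S mulrAC ler_pdivrMr ?ltr_wpDl// ler_wpM2l ?ltW// ltrDl.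
- move=> A HA; have HA' := HC (A^T *m xi).
  rewrite (le_trans (lerD (ler_normB _ _) (ler_normB _ _)))// addrACA lerD2r.
  rewrite (le_trans _ (ler_norm C))//; apply: HA' => l.
  apply: transpose_mul_entry_le => j.
  have [->|[y yx ->]] := HA j l; first by rewrite normr0.
  exact: Hb.
- apply: ler_wpM2l; first exact: ltW.
  rewrite [leRHS]splitr lerD2l.
  rewrite (le_trans (ler_wpM2l C'0 (Ht0 t (ltW t_gt0) tt0)))//.
  rewrite mulrA ler_pdivrMr ?ltr_wpDl// mulrC.
  by apply: ler_wpM2l; [exact: ltW|rewrite lerDl].
Qed.

End start.

End solution.

(** * The symbol *)

Section complex_limits.
Context {R : realType}.

Lemma normc_le_sum (z : R[i]) :
  `|z| <= (`|complex.Re z| + `|complex.Im z|)%:C.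
Proof.
case: z => a b /=; rewrite normc_def/= lecR.
rewrite -[leRHS]ger0_norm ?addr_ge0// -[leRHS]sqrtr_sqr ler_wsqrtr//.
rewrite sqrrD !real_normK ?num_real// lerD2r lerDl mulrn_wge0// mulr_ge0//.
Qed.

Lemma cvg_complex (T : Type) (G : set_system T) {FG : Filter G} (f g : T -> R) a b :
  f x @[x --> G] --> a -> g x @[x --> G] --> b ->
  (f x +i* g x : R[i]^o) @[x --> G] --> (a +i* b : R[i]^o).
Proof.
move=> /cvgrPdist_lt fa /cvgrPdist_lt gb; apply/cvgrPdist_lt => e e0.
(* The norm on [R[i]] takes complex values, and a positive complex number is real. *)
have [e1 e2] : 0 < complex.Re e /\ e = (complex.Re e)%:C.
  by move: e0; case: e => u v; rewrite ltcE /= => /andP[/eqP -> ->].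
have h0 : 0 < complex.Re e / 2 by rewrite divr_gt0.
have := fa _ h0; have := gb _ h0; apply: filterS2 => x gx fx.
rewrite e2; apply: le_lt_trans (normc_le_sum _) _.
rewrite ltcR /= [ltRHS]splitr; exact: ltrD.
Qed.

(** The quotient is a difference quotient at 0, since the damped cosine equals [cos p] there; the
    limit is its derivative. *)
Lemma damped_cos_quotient (a b p : R) :
  (expR (- (t * a)) * cos (t * b + p) - cos p) / t @[t --> 0^'+] -->
    - a * cos p - b * sin p.
Proof.
pose f (t : R) := expR (- (t * a)) * cos (t * b + p).
have d1 : is_derive (0 : R) 1 (fun t => - (t * a)) (- a).
  rewrite (_ : (fun t => _) = - (a *: id)); last first.
    by apply/funext => t; rewrite mulrC.
  by apply: is_derive_eq; rewrite scaler1.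
have d2 : is_derive (0 : R) 1 (fun t => t * b + p) b.
  rewrite (_ : (fun t => _) = (b *: id) + cst p); last first.
    by apply/funext => t; rewrite mulrC.
  by apply: is_derive_eq; rewrite addr0 scaler1.
have d3 : is_derive (0 : R) 1 (expR \o (fun t => - (t * a)))
    (expR (- (0 * a)) * - a).
  exact: is_derive1_comp.
have d4 : is_derive (0 : R) 1 (cos \o (fun t => t * b + p)) (- sin (0 * b + p) * b).
  exact: is_derive1_comp.
have df : is_derive (0 : R) 1 f (- a * cos p - b * sin p).
  rewrite (_ : f = (expR \o (fun t => - (t * a))) * (cos \o (fun t => t * b + p)))//.
  apply: is_derive_eq; rewrite /= !mul0r oppr0 expR0 add0r /GRing.scale/=; ring.
have := @ex_derive _ _ _ _ _ _ _ df; rewrite /derivable => cf.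
have := @derive_val _ _ _ _ _ _ _ df; rewrite /derive => lf.
rewrite -lf; apply: cvg_dnbhs_at_right; apply: cvg_trans cf; apply: near_eq_cvg.
near=> t; rewrite /= addr0 /GRing.scale/= mulr1 /f !mul0r oppr0 expR0 mul1r add0r.
by rewrite mulrC.
Unshelve. all: by end_near. Qed.

Lemma cexp_quotient (u t : R) :
  (cexp ('i * u%:C) - 1) / t%:C = ((cos u - 1) / t +i* (sin u / t)).
Proof.
rewrite cexp_i -fmorphV; apply/eqP; rewrite eq_complex /=.
by rewrite !mulr0 !subr0 add0r !eqxx.
Qed.

End complex_limits.

Theorem theorem3p1 (R : realType) (dO : measure_display)
  (Omega : measurableType dO) (P : probability Omega R)
  (F : R -> set_system Omega) (d n : nat)
  (Z : R -> Omega -> 'cV[R]_n) (psi : 'cV[R]_n -> R[i])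
  (Phi : 'cV[R]_d -> 'M[R]_(d, n))
  (X : R -> Obar (Omega := Omega) d -> 'cV[R]_d)
  (hF : filtration F)
  (hZ : levy_process P F Z)
  (hpsi : characteristic_exponent P Z psi)
  (hLip : locally_lipschitz Phi)
  (hgrowth : exists2 K : R, 0 < K &
    forall x, frobenius (Phi x) ^+ 2 <= K * (1 + frobenius x ^+ 2))
  (hX : sde_solution P F Z Phi X) :
  has_symbol P X (fun x xi => psi ((Phi x)^T *m xi)).
Proof.
move=> x xi r r0; have [cX aX /(_ x)[I hI hXI]] := hX.
set psi0 := psi _.
pose U t w := dot (X (hit (exit_set X x r) t w) w - x) xi.
(* Phase 0 gives the real part of the quotient in the symbol; phase [pi / 2] gives the imaginary
   part, since [cos(u - pi / 2) = sin u]. *)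
pose Q p t := (\int[P]_w cos (U t (x, w) - p) - cos p) / t.
have Q_cvg p : Q p t @[t --> 0^'+] -->
    - complex.Re psi0 * cos p - complex.Im psi0 * sin p.
  apply/cvgrPdist_le => e e0; have h0 : 0 < e / 2 by rewrite divr_gt0.
  have [t0 t00 H] := stopped_asymptotics hF hZ hpsi hLip cX aX hI hXI hgrowth xi r0 h0.
  have /cvgrPdist_le/(_ _ h0) quot :=
    @damped_cos_quotient R (complex.Re psi0) (complex.Im psi0) p.
  near=> t.
  have t_gt0 : 0 < t by near: t; exact: nbhs_right_gt.
  have tt0 : t <= t0 by near: t; exact: nbhs_right_le.
  (* The same quotient for the exact exponential [exp(- t psi0)]: its distance to the limit is
     calculus, and its distance to [Q p t] is the asymptotic estimate divided by [t]. *)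
  pose q := (expR (- (t * complex.Re psi0)) * cos (t * complex.Im psi0 + p) - cos p) / t.
  rewrite [leRHS]splitr (le_trans (ler_distD q _ _))// lerD//.
    by rewrite /q; near: t; exact: quot.
  rewrite distrC /Q /q -mulrBl opprB addrA subrK normrM.
  rewrite [X in _ * X]gtr0_norm ?invr_gt0// ler_pdivrMr// [leRHS]mulrC.
  exact: H.
have Re_cvg := Q_cvg 0; have Im_cvg := Q_cvg (pi / 2).
rewrite cos0 sin0 mulr1 mulr0 subr0 in Re_cvg.
rewrite cos_pihalf sin_pihalf mulr1 mulr0 add0r in Im_cvg.
have psi0E : (complex.Re psi0 +i* complex.Im psi0) = psi0 by rewrite /psi0; case: (psi _).
have : (- Q 0 t +i* - Q (pi / 2) t : R[i]^o) @[t --> 0^'+] --> (psi0 : R[i]^o).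
  rewrite -psi0E -(opprK (complex.Re _)) -(opprK (complex.Im _)).
  by apply: cvg_complex; apply: cvgN.
apply: cvg_trans; apply: near_eq_cvg; near=> t.
have t_gt0 : 0 < t by near: t; exact: nbhs_right_gt.
have mU : measurable_fun setT (U t).
  exact: (measurable_stopped_dot hF cX aX x r xi (ltW t_gt0)).
(* Common to both parts: the integral passes from the enlarged space to [Omega], and linearity pulls
   out [c] and [1 / t]. *)
have intE (f : R -> R) c : measurable_fun setT f -> (forall u, `|f u| <= 1) ->
    \int[Pbar P x]_w ((f (U t w) - c) / t) = (\int[P]_w f (U t (x, w)) - c) / t.
  move=> mf f1.
  have mfU : measurable_fun setT (f \o U t) by exact: measurableT_comp.
  have mfx : measurable_fun setT (fun w => f (U t (x, w))).
    by move=> _ A mA; have := mfU measurableT A mA; rewrite !setTI; exact: measurable_section.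
  rewrite (@Rintegral_section _ _ _ P _ x _ ((1 + `|c|) / t)).
  - rewrite RintegralZr//; last first.
      apply: (@bounded_integrable _ _ _ P _ (1 + `|c|)) => [|w].
        exact: measurable_funB.
      by rewrite (le_trans (ler_normB _ _))// lerD2r.
    rewrite RintegralB//; last 2 first.
    + exact: (@bounded_integrable _ _ _ P _ 1).
    + by apply: (@bounded_integrable _ _ _ P _ `|c|).
    by rewrite Rintegral_const.
  - by apply: measurable_funM => //; apply: measurable_funB.
  - move=> w; rewrite normrM (gtr0_norm (x := t^-1)) ?invr_gt0//.
    rewrite ler_pM2r ?invr_gt0//.
    by rewrite (le_trans (ler_normB _ _))// lerD2r.
have cosE : \int[Pbar P x]_w ((cos (U t w) - 1) / t) = Q 0 t.
  rewrite intE; last 2 first.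
  - exact: measurable_cos.
  - by move=> u; rewrite ler_norml cos_geN1 cos_le1.
  by rewrite /Q cos0; under [in RHS]eq_Rintegral do rewrite subr0.
have sinE : \int[Pbar P x]_w (sin (U t w) / t) = Q (pi / 2) t.
  under eq_Rintegral do rewrite -[sin _]subr0.
  rewrite intE; last 2 first.
  - exact: measurable_sin.
  - by move=> u; rewrite ler_norml sin_geN1 sin_le1.
  by rewrite /Q cos_pihalf; under [in RHS]eq_Rintegral do rewrite cosBpihalf.
rewrite [X in _ = - cexpectation _ X](_ : _ =
    (fun w => (cos (U t w) - 1) / t +i* (sin (U t w) / t))).
  by rewrite /cexpectation/= cosE sinE.
by apply/funext => w; rewrite stopped_exit_time ?ltW// cexp_quotient.
Unshelve. all: by end_near. Qed.
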